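(* Let $G$ be a compact group. For each separable unitary representation $(\mathcal H_\mu,\mu)$ of $G$, let $s_\mu$ be a $G$-invariant strictly positive element of $\mathcal K(\mathcal H_\mu)$. Then the map $s\colon\mathrm{Cu}(G)\to\mathrm{Cu}^G(\mathbb C)$ given by $s([\mu])=[s_\mu]_G$, for $[\mu]\in\mathrm{Cu}(G)$, is well defined. Moreover, it is an isomorphism of ordered semigroups.
   Context: $\mathrm{Cu}(G)$ is the set of unitary equivalence classes $[\mu]$ of unitary representations $(\mathcal H_\mu,\mu)$ of $G$ on separable Hilbert spaces, with addition given by direct sum and order $[\mu]\le[\nu]$ iff $\mu$ is unitarily equivalent to a subrepresentation of $\nu$. $G$ acts on $\mathcal K(\mathcal H_\mu)$ by $\mathrm{Ad}(\mu)$ and on $\mathcal K(\mathcal H_\nu,\mathcal H_\mu)$ by $g\cdot T=\mu_g T\nu_{g^{-1}}$; a superscript $G$ denotes fixed points. For positive $a\in\mathcal K(\mathcal H_\mu)^G$ and $b\in\mathcal K(\mathcal H_\nu)^G$, write $a\precsim_G b$ if there are $d_n\in\mathcal K(\mathcal H_\nu,\mathcal H_\mu)^G$ with $\|d_nbd_n^*-a\|\to0$, and $a\sim_G b$ if $a\precsim_G b$ and $b\precsim_G a$. $\mathrm{Cu}^G(\mathbb C)$ (the equivariant Cuntz semigroup of $\mathbb C$ with the trivial action) is the set of $\sim_G$-classes $[a]_G$ of positive elements $a\in\mathcal K(\mathcal H_\mu)^G$, over all separable unitary representations $(\mathcal H_\mu,\mu)$, with $[a]_G+[b]_G=[a\oplus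 b]_G$ and $[a]_G\le[b]_G$ iff $a\precsim_G b$. A $G$-invariant strictly positive element of $\mathcal K(\mathcal H_\mu)$ always exists, by averaging a strictly positive element over $G$ with respect to normalized Haar measure. *)

(* Defs.v *)
From HB Require Import structures.
From mathcomp Require Import all_boot all_order all_algebra.
From mathcomp Require Import complex ring lra.
From mathcomp Require Import all_classical all_reals all_analysis.

Set Implicit Arguments.
Unset Strict Implicit.
Unset Printing Implicit Defensive.

Import Order.TTheory GRing.Theory Num.Theory.
Import numFieldNormedType.Exports.

Local Open Scope classical_set_scope.
Local Open Scope ring_scope.

HB.mixin Record isTopologicalGroup (G : Type) of Topological G & Group G := {
  mulg_continuous : continuous (fun xy : G * G => (xy.1 * xy.2)%g);
  invg_continuous : continuous (fun x : G => (x^-1)%g)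
}.

#[short(type="topologicalGroupType")]
HB.structure Definition TopologicalGroup :=
  {G of Topological G & Group G & isTopologicalGroup G}.

(* The scalars are the complex numbers R[i]; inner products are linear in the
   first variable. *)
HB.mixin Record CompleteNormedModule_isHilbert (R : realType) (H : Type)
    of CompleteNormedModule R[i] H := {
  dotp : {dot H for @Num.conj R[i]};
  dotp_norm : forall x : H, dotp x x = `|x| ^+ 2
}.

#[short(type="hilbertType")]
HB.structure Definition Hilbert (R : realType) :=
  {H of CompleteNormedModule R[i] H & CompleteNormedModule_isHilbert R H}.

Arguments dotp {R s} : rename.

(* The quotient is built by hand because the carriers below, types of all
   Hilbert space representations, live in a universe above that of choiceType
   (hence of {eq_quot _}) and of set. *)
Section Quotient.
Context (T : Type) (E : T -> T -> Prop).

Record quotient : Type := Quotient {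
  quotient_class : T -> Prop;
  quotient_classP : exists x, quotient_class = E x }.

Definition class_of (x : T) : quotient :=
  @Quotient (E x) (ex_intro _ x erefl).

Definition repr_of (q : quotient) : T := projT1 (cid (quotient_classP q)).

Lemma repr_ofK q : class_of (repr_of q) = q.
Proof.
rewrite /repr_of; case: cid => x /=; case: q => c cP /= cE.
by subst c; congr Quotient; exact: Prop_irrelevance.
Qed.

Lemma class_ofP :
  (forall x, E x x) -> (forall x y, E x y -> E y x) ->
  (forall x y z, E x y -> E y z -> E x z) ->
  forall x y, class_of x = class_of y <-> E x y.
Proof.
move=> Er Es Et x y; split=> [[xy]|xy]; first by rewrite xy.
suff xyE : E x = E y.
  rewrite /class_of; move: (ex_intro _ x _) (ex_intro _ y _).
  by rewrite xyE => p q; congr Quotient; exact: Prop_irrelevance.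
apply/funext => z; apply/propext; split; first exact: Et (Es _ _ xy).
exact: Et xy.
Qed.

End Quotient.

Lemma sqrtC_sqrD_le (C : numClosedFieldType) (a b c d : C) :
  0 <= a -> 0 <= b -> 0 <= c -> 0 <= d ->
  sqrtC ((a + b) ^+ 2 + (c + d) ^+ 2) <=
  sqrtC (a ^+ 2 + c ^+ 2) + sqrtC (b ^+ 2 + d ^+ 2).
Proof.
move=> a0 b0 c0 d0.
have s0 (x y : C) : 0 <= x -> 0 <= y -> 0 <= x ^+ 2 + y ^+ 2.
  by move=> ? ?; rewrite addr_ge0 ?exprn_ge0.
have L0 : 0 <= sqrtC ((a + b) ^+ 2 + (c + d) ^+ 2).
  by rewrite sqrtC_ge0 s0 // addr_ge0.
have R0 : 0 <= sqrtC (a ^+ 2 + c ^+ 2) + sqrtC (b ^+ 2 + d ^+ 2).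
  by rewrite addr_ge0 // sqrtC_ge0 s0.
rewrite -(@ler_pXn2r _ 2 isT) ?nnegrE // [leRHS]sqrrD !sqrtCK.
have cs : a * b + c * d <= sqrtC (a ^+ 2 + c ^+ 2) * sqrtC (b ^+ 2 + d ^+ 2).
  rewrite -rootCMl ?s0 // -(@ler_pXn2r _ 2 isT) ?nnegrE ?sqrtC_ge0 ?sqrtCK; last 2 first.
  - by rewrite addr_ge0 // mulr_ge0.
  - by rewrite mulr_ge0 ?s0.
  rewrite -subr_ge0.
  have -> : (a ^+ 2 + c ^+ 2) * (b ^+ 2 + d ^+ 2) - (a * b + c * d) ^+ 2 =
    (a * d - b * c) ^+ 2 by ring.
  by rewrite real_exprn_even_ge0 // realB // ger0_real // mulr_ge0.
rewrite -subr_ge0.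
set S := sqrtC _ * sqrtC _ in cs *.
have -> : a ^+ 2 + c ^+ 2 + S *+ 2 + (b ^+ 2 + d ^+ 2) -
  ((a + b) ^+ 2 + (c + d) ^+ 2) = (S - (a * b + c * d)) *+ 2 by ring.
by rewrite mulrn_wge0 // subr_ge0.
Qed.

Section HilbertSum.
Context (R : realType) (H K : hilbertType R).

(* The normed product H * K of the library carries the sup norm; the alias
   hsum is the same module with the norm sqrt(|x|^2 + |y|^2). *)
Definition hsum : Type := (H * K)%type.

HB.instance Definition _ := GRing.Lmodule.copy hsum (H * K)%type.

Definition hsum_norm (x : hsum) : R[i] :=
  sqrtC (`|x.1| ^+ 2 + `|x.2| ^+ 2).

Lemma hsum_normD x y : hsum_norm (x + y) <= hsum_norm x + hsum_norm y.
Proof.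
apply: le_trans (sqrtC_sqrD_le _ _ _ _); rewrite ?normr_ge0 //.
rewrite ler_sqrtC ?nnegrE ?addr_ge0 ?exprn_ge0 ?addr_ge0 //.
by rewrite lerD // lerXn2r ?nnegrE ?addr_ge0 ?ler_normD.
Qed.

Lemma hsum_normZ (c : R[i]) x : hsum_norm (c *: x) = `|c| * hsum_norm x.
Proof.
rewrite /hsum_norm /= !normrZ !exprMn -mulrDr rootCMl ?exprn_ge0 //.
by rewrite sqrCK.
Qed.

Lemma hsum_norm_eq0 x : hsum_norm x = 0 -> x = 0.
Proof.
move=> /eqP; rewrite sqrtC_eq0 paddr_eq0 ?exprn_ge0 // !sqrf_eq0 !normr_eq0.
by case: x => x1 x2 /= /andP[/eqP -> /eqP ->].
Qed.

HB.instance Definition _ :=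
  Lmodule_isNormed.Build R[i] hsum hsum_normD hsum_normZ hsum_norm_eq0.

Lemma hsum_normE (x : hsum) : `|x| = sqrtC (`|x.1| ^+ 2 + `|x.2| ^+ 2).
Proof. by []. Qed.

Lemma hsum_norm_sqr (x : hsum) : `|x| ^+ 2 = `|x.1| ^+ 2 + `|x.2| ^+ 2.
Proof. by rewrite hsum_normE sqrtCK. Qed.

Lemma hsum_norm1 (x : hsum) : `|x.1| <= `|x|.
Proof.
by rewrite -(@ler_pXn2r _ 2 isT) ?nnegrE // hsum_norm_sqr lerDl exprn_ge0.
Qed.

Lemma hsum_norm2 (x : hsum) : `|x.2| <= `|x|.
Proof.
by rewrite -(@ler_pXn2r _ 2 isT) ?nnegrE // hsum_norm_sqr lerDr exprn_ge0.
Qed.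

Lemma hsum_norm_le (x : hsum) : `|x| <= `|x.1| + `|x.2|.
Proof.
rewrite -(@ler_pXn2r _ 2 isT) ?nnegrE ?addr_ge0 // hsum_norm_sqr sqrrD.
by rewrite -addrA lerD2l lerDr mulrn_wge0 // mulr_ge0.
Qed.

Lemma hsum_cvg T (F : set_system T) {FF : Filter F} (f : T -> hsum) (l : hsum) :
  (fun t => (f t).1) @ F --> l.1 -> (fun t => (f t).2) @ F --> l.2 ->
  f @ F --> l.
Proof.
move=> f1 f2; apply/cvgrPdist_lt => e e0.
have e2 : 0 < e / 2 by rewrite divr_gt0.
near=> t.
rewrite (le_lt_trans (hsum_norm_le _)) //= [ltRHS]splitr ltrD //.
- by near: t; move/cvgrPdist_lt : f1; apply.
- by near: t; move/cvgrPdist_lt : f2; apply.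
Unshelve. all: by end_near. Qed.

Lemma hsum_complete (F : set_system hsum) : ProperFilter F -> cauchy F -> cvg F.
Proof.
move=> FF /cauchy_ballP cF.
have c1 : cvg (fst @ F : set_system H).
  apply/cauchy_cvgP/cauchy_ballP => e e0.
  have [[A B] /= [FA FB] AB] := cF _ e0.
  exists (fst @` A, fst @` B); first by split=> /=;
    [apply: filterS FA|apply: filterS FB] => x Ax; exists x.
  move=> [_ _] /= [[x Ax <-] [y By <-]].
  have /= := AB (x, y) (conj Ax By); rewrite -!ball_normE /=.
  by move=> /(le_lt_trans _); apply; exact: (hsum_norm1 (x - y)).
have c2 : cvg (snd @ F : set_system K).
  apply/cauchy_cvgP/cauchy_ballP => e e0.
  have [[A B] /= [FA FB] AB] := cF _ e0.
  exists (snd @` A, snd @` B); first by split=> /=;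
    [apply: filterS FA|apply: filterS FB] => x Ax; exists x.
  move=> [_ _] /= [[x Ax <-] [y By <-]].
  have /= := AB (x, y) (conj Ax By); rewrite -!ball_normE /=.
  by move=> /(le_lt_trans _); apply; exact: (hsum_norm2 (x - y)).
move/cvg_ex : c1 => [l1 l1P]; move/cvg_ex : c2 => [l2 l2P].
apply/cvg_ex; exists ((l1, l2) : hsum).
exact: (@hsum_cvg _ F _ id (l1, l2)).
Qed.

HB.instance Definition _ := Uniform_isComplete.Build hsum hsum_complete.

Definition hsum_dot (x y : hsum) : R[i] := dotp x.1 y.1 + dotp x.2 y.2.

Lemma hsum_dot_bilinear :
  bilinear_for *%R (@Num.conj R[i] \; *%R) hsum_dot.
Proof.
split=> [u|u] c x y; rewrite /hsum_dot /=.
- by rewrite !linearPl /= mulrDr addrACA.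
- by rewrite !linearPr /= mulrDr addrACA.
Qed.

HB.instance Definition _ := bilinear_isBilinear.Build R[i] hsum hsum R[i]
  *%R (@Num.conj R[i] \; *%R) hsum_dot hsum_dot_bilinear.

Lemma hsum_dot_hermitian (x y : hsum) :
  hsum_dot x y = (-1) ^+ false * Num.conj (hsum_dot y x).
Proof.
rewrite /hsum_dot expr0 mul1r rmorphD /=.
by congr (_ + _); rewrite [LHS]hermC expr0 mul1r.
Qed.

HB.instance Definition _ := isHermitianSesquilinear.Build R[i] hsum false
  (@Num.conj R[i]) hsum_dot hsum_dot_hermitian.

Lemma hsum_dot_norm (x : hsum) : hsum_dot x x = `|x| ^+ 2.
Proof. by rewrite hsum_norm_sqr /hsum_dot !dotp_norm. Qed.

Lemma hsum_dot_gt0 (x : hsum) : x != 0 -> 0 < hsum_dot x x.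
Proof. by move=> x0; rewrite hsum_dot_norm exprn_gt0 // normr_gt0. Qed.

HB.instance Definition _ := isDotProduct.Build R[i] hsum hsum_dot hsum_dot_gt0.

HB.instance Definition _ :=
  CompleteNormedModule_isHilbert.Build R hsum hsum_dot_norm.

End HilbertSum.

Section Operators.
Context (R : realType).
Implicit Types H K : hilbertType R.

Definition compact_op H K (T : H -> K) : Prop :=
  linear T /\ precompact (T @` [set x | `|x| <= 1]).

Definition adjoint H K (T : H -> K) (S : K -> H) : Prop :=
  forall x y, dotp (T x) y = dotp x (S y).

Definition positive_op H (T : H -> H) : Prop :=
  forall x, 0 <= dotp (T x) x.

(* Meaningful for bounded T only: sup is 0 on unbounded sets. *)
Definition opnorm H K (T : H -> K) : R :=
  sup [set complex.Re `|T x| | x in [set x : H | `|x| <= 1]].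

(* phi stands for a positive linear functional on the C*-algebra of compact
   operators; its values off that algebra are irrelevant. *)
Definition positive_functional H (phi : (H -> H) -> R[i]) : Prop :=
  (forall (c : R[i]) S T, compact_op S -> compact_op T ->
     phi (c *: S + T) = c * phi S + phi T) /\
  (forall T, compact_op T -> positive_op T -> 0 <= phi T).

(* Strict positivity in the C*-algebra of compact operators: every nonzero
   positive functional is positive at a. *)
Definition strictly_positive H (a : H -> H) : Prop :=
  [/\ compact_op a, positive_op a &
   forall phi : (H -> H) -> R[i], positive_functional phi ->
     (exists2 T, compact_op T & phi T != 0) -> 0 < phi a].

End Operators.

Section RealInner.
Context (R : realType).
Implicit Types H K : hilbertType R.

Definition hnorm H (x : H) : R := complex.Re `|x|.
Definition rdot H (x y : H) : R := complex.Re (dotp x y).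

Lemma hnormE H (x : H) : (hnorm x)%:C%C = `|x|.
Proof. by rewrite /hnorm RRe_real // normr_real. Qed.

Lemma hnorm_ge0 H (x : H) : 0 <= hnorm x.
Proof. by rewrite -lecR hnormE; exact: normr_ge0. Qed.

Lemma hnorm_le H K (x : H) (y : K) : (`|x| <= `|y|) = (hnorm x <= hnorm y).
Proof. by rewrite -!hnormE lecR. Qed.

Lemma hnorm_leM H K (x : H) (y : K) (M : R) :
  (`|x| <= M%:C%C * `|y|) = (hnorm x <= M * hnorm y).
Proof. by rewrite -!hnormE -rmorphM lecR. Qed.

Lemma hnormZ H (c : R) (x : H) : hnorm (c%:C%C *: x) = `|c| * hnorm x.
Proof.
apply: (@complexI R); rewrite hnormE normrZ rmorphM /= hnormE; congr (_ * _).
by rewrite normc_def /= expr0n addr0 sqrtr_sqr.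
Qed.

Lemma hnormN H (x : H) : hnorm (- x) = hnorm x.
Proof. by rewrite /hnorm normrN. Qed.

Lemma hnorm0 H : hnorm (0 : H) = 0.
Proof. by rewrite /hnorm normr0. Qed.

Lemma hnorm_eq0 H (x : H) : hnorm x = 0 -> x = 0.
Proof. by move=> x0; apply/eqP; rewrite -normr_eq0 -hnormE x0. Qed.

Lemma hnormD H (x y : H) : hnorm (x + y) <= hnorm x + hnorm y.
Proof. by rewrite -lecR rmorphD /= !hnormE ler_normD. Qed.

Lemma rdot_norm H (x : H) : rdot x x = hnorm x ^+ 2.
Proof.
rewrite /rdot dotp_norm -hnormE -rmorphXn /=.
by [].
Qed.

Lemma dotpC H (x y : H) : dotp x y = Num.conj (dotp y x).
Proof. by rewrite [LHS]hermC expr0 mul1r. Qed.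

Lemma rdotC H (x y : H) : rdot x y = rdot y x.
Proof. by rewrite /rdot dotpC; case: (dotp y x). Qed.

Lemma rdotDl H (x y z : H) : rdot (x + y) z = rdot x z + rdot y z.
Proof. by rewrite /rdot linearDl raddfD. Qed.

Lemma rdotNl H (x z : H) : rdot (- x) z = - rdot x z.
Proof. by rewrite /rdot linearNl raddfN. Qed.

Lemma rdotZl H (c : R) (x z : H) : rdot (c%:C%C *: x) z = c * rdot x z.
Proof.
rewrite /rdot linearZl_LR /=.
by case: (dotp x z) => u v /=; rewrite mul0r subr0.
Qed.

Lemma rdotDr H (x y z : H) : rdot z (x + y) = rdot z x + rdot z y.
Proof. by rewrite !(rdotC z) rdotDl. Qed.

Lemma rdotNr H (x z : H) : rdot z (- x) = - rdot z x.
Proof. by rewrite !(rdotC z) rdotNl. Qed.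

Lemma rdotZr H (c : R) (x z : H) : rdot z (c%:C%C *: x) = c * rdot z x.
Proof. by rewrite !(rdotC z) rdotZl. Qed.

Lemma dotp_eq0P H (x : H) : (forall y, dotp x y = 0) -> x = 0.
Proof.
by move=> /(_ x); rewrite dotp_norm => /eqP; rewrite sqrf_eq0 normr_eq0 => /eqP.
Qed.

End RealInner.

Section CompactOperators.
Context (R : realType).
Implicit Types H K L : hilbertType R.

Definition bounded_op H K (T : H -> K) : Prop :=
  exists M : R, 0 < M /\ forall x, hnorm (T x) <= M * hnorm x.

Lemma linear_op0 H K (T : H -> K) : linear T -> T 0 = 0.
Proof. by move=> lT; have := lT (-1) 0 0; rewrite scaler0 addr0 scaleN1r addNr. Qed.

Lemma linear_opZ H K (T : H -> K) c x : linear T -> T (c *: x) = c *: T x.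
Proof. by move=> lT; rewrite -[c *: x]addr0 lT linear_op0 // addr0. Qed.

Lemma linear_opD H K (T : H -> K) x y : linear T -> T (x + y) = T x + T y.
Proof. by move=> lT; rewrite -[x]scale1r lT !scale1r. Qed.

Lemma linear_opN H K (T : H -> K) x : linear T -> T (- x) = - T x.
Proof. by move=> lT; rewrite -scaleN1r linear_opZ // scaleN1r. Qed.

Lemma precompact_continuous H K (f : H -> K) (A : set H) :
  continuous f -> precompact A -> precompact (f @` A).
Proof.
move=> cf; rewrite precompactE => cA.
apply: (@precompact_subset _ _ (f @` closure A)).
  by move=> _ [x Ax <-]; exists x => //; exact: subset_closure.
apply: compact_precompact; first exact: norm_hausdorff.
by apply: continuous_compact => //; exact: continuous_subspaceT.
Qed.

Lemma precompact_continuous2 H K L (f : H * K -> L) (A : set H) (B : set K) :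
  continuous f -> precompact A -> precompact B -> precompact (f @` (A `*` B)).
Proof.
move=> cf cA cB; rewrite precompactE in cA; rewrite precompactE in cB.
apply: (@precompact_subset _ _ (f @` (closure A `*` closure B))).
  move=> _ [x [Ax Bx] <-]; exists x => //; split; exact: subset_closure.
apply: compact_precompact; first exact: norm_hausdorff.
apply: continuous_compact; first exact: continuous_subspaceT.
exact: compact_setX.
Qed.

Lemma hnorm_continuous H : continuous (@hnorm R H).
Proof.
move=> x; apply/cvgrPdist_lt => e e0.
have e0' : 0 < e%:C%C by rewrite ltcR.
near=> y.
have : `|x - y| < e%:C%C.
  near: y; move: (e%:C%C) e0'.
  by apply/cvgrPdist_lt; exact: cvg_id.
rewrite -hnormE ltcR; apply: le_lt_trans.
have h1 : hnorm x <= hnorm (x - y) + hnorm y.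
  by rewrite -{1}(subrK y x) hnormD.
have h2 : hnorm y <= hnorm (x - y) + hnorm x.
  by rewrite -(hnormN (x - y)) opprB -{1}(subrK x y) hnormD.
by rewrite ler_norml; lra.
Unshelve. all: by end_near. Qed.

Lemma compact_op_bounded H K (T : H -> K) : compact_op T -> bounded_op T.
Proof.
move=> [lT]; rewrite precompactE => cT.
have /compact_bounded[M [_ MT]] :
    compact (@hnorm R K @` closure (T @` [set x | `|x| <= 1])).
  by apply: continuous_compact => //; apply: continuous_subspaceT;
    exact: hnorm_continuous.
have M1 : M < `|M| + 1 by rewrite (le_lt_trans (ler_norm _)) // ltrDl.
exists (`|M| + 1); split; first by rewrite ltr_wpDl.
have bT x : `|x| <= 1 -> hnorm (T x) <= `|M| + 1.
  move=> x1; have := MT _ M1 (hnorm (T x)).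
  rewrite /= ger0_norm ?hnorm_ge0 //; apply.
  by exists (T x) => //; apply: subset_closure; exists x.
move=> x; have [x0|x0] := eqVneq (hnorm x) 0.
  by rewrite (hnorm_eq0 x0) linear_op0 // !hnorm0 mulr0.
have x_gt0 : 0 < hnorm x by rewrite lt_neqAle eq_sym x0 hnorm_ge0.
have := bT ((hnorm x)^-1%:C%C *: x).
rewrite linear_opZ // -[X in X <= _]hnormE !hnormZ.
rewrite ger0_norm ?invr_ge0 ?hnorm_ge0 // mulVf // => /(_ (lexx _)).
by rewrite mulrC ler_pdivrMr.
Qed.

Lemma bounded_linear_op_continuous H K (T : H -> K) :
  linear T -> bounded_op T -> continuous T.
Proof.
move=> lT [M [M0 bT]] x; apply/cvgrPdist_lt => e e0.
have M0' : 0 < M%:C%C by rewrite ltcR.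
near=> y.
have : `|x - y| < e / M%:C%C.
  near: y; move: (e / M%:C%C) (divr_gt0 e0 M0').
  by apply/cvgrPdist_lt; exact: cvg_id.
rewrite ltr_pdivlMr //; apply: le_lt_trans.
by rewrite -linear_opN // -linear_opD // mulrC hnorm_leM.
Unshelve. all: by end_near. Qed.

Lemma bounded_op_comp H K L (T : K -> L) (S : H -> K) :
  bounded_op T -> bounded_op S -> bounded_op (T \o S).
Proof.
move=> [M [M0 bT]] [N [N0 bS]]; exists (M * N); split; first exact: mulr_gt0.
by move=> x /=; rewrite (le_trans (bT _)) // -mulrA ler_wpM2l // ltW.
Qed.

Lemma bounded_op_add H K (T S : H -> K) :
  bounded_op T -> bounded_op S -> bounded_op (T + S).
Proof.
move=> [M [M0 bT]] [N [N0 bS]]; exists (M + N); split; first exact: addr_gt0.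
by move=> x /=; rewrite (le_trans (hnormD _ _)) // mulrDl lerD.
Qed.

Lemma bounded_op_opp H K (T : H -> K) : bounded_op T -> bounded_op (- T).
Proof.
move=> [M [M0 bT]]; exists M; split=> // x.
by rewrite [(- T) x]/(- (T x)) hnormN.
Qed.

Lemma compact_op_comp H K L (T : K -> L) (S : H -> K) :
  compact_op T -> linear S -> bounded_op S -> compact_op (T \o S).
Proof.
move=> [lT cT] lS [M [M0 bS]]; split.
  by move=> c x y /=; rewrite lS lT.
apply: (@precompact_subset _ _
  ((fun y => M%:C%C *: y) @` (T @` [set x | `|x| <= 1]))); last first.
  by apply: precompact_continuous => //; exact: scaler_continuous.
move=> _ [x x1 <-] /=.
exists (T (M^-1%:C%C *: S x)).
  exists (M^-1%:C%C *: S x) => //=.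
  rewrite -hnormE -[leRHS]/((1 : R)%:C%C) lecR hnormZ ger0_norm ?invr_ge0 ?(ltW M0) //.
  rewrite mulrC ler_pdivrMr // mul1r (le_trans (bS x)) //.
  by rewrite -[leRHS]mulr1 ler_pM2l // -lecR hnormE.
rewrite linear_opZ // scalerA -rmorphM /= mulfV ?gt_eqF //.
by rewrite -[_%:C%C]/(1 : R[i]) scale1r.
Qed.

Lemma compact_op_add H K (T S : H -> K) :
  compact_op T -> compact_op S -> compact_op (T + S).
Proof.
move=> [lT cT] [lS cS]; split.
  move=> c x y; rewrite [LHS]/(T _ + S _) lT lS scalerDr addrACA.
  by [].
apply: precompact_subset (precompact_continuous2 (@add_continuous _) cT cS).
by move=> _ [x x1 <-]; exists (T x, S x) => //; split; exists x.
Qed.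

Lemma adjoint_linear H K (T : H -> K) (S : K -> H) : adjoint T S -> linear S.
Proof.
move=> TS c x y; apply/eqP; rewrite -subr_eq0; apply/eqP/dotp_eq0P => z.
rewrite dotpC linearDr linearNr linearPr /= -!TS linearPr /= subrr.
by rewrite rmorph0.
Qed.

Lemma adjoint_rdot H K (T : H -> K) (S : K -> H) x y :
  adjoint T S -> rdot (T x) y = rdot x (S y).
Proof. by move=> TS; rewrite /rdot TS. Qed.

Lemma adjoint_bounded H K (T : H -> K) (S : K -> H) :
  adjoint T S -> bounded_op T -> bounded_op S.
Proof.
move=> TS [M [M0 bT]]; exists M; split=> // y.
have S2 : rdot (T (S y)) y = hnorm (S y) ^+ 2 by rewrite (adjoint_rdot _ _ TS) rdot_norm.
have : 0 <= hnorm (T (S y) - (M ^+ 2)%:C%C *: y) ^+ 2 by rewrite exprn_ge0 ?hnorm_ge0.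
rewrite -rdot_norm !(rdotDl, rdotDr, rdotNl, rdotNr, rdotZl, rdotZr).
rewrite (rdotC y) S2 !rdot_norm => h.
have h1 : hnorm (T (S y)) ^+ 2 <= (M * hnorm (S y)) ^+ 2.
  by rewrite ler_sqr ?nnegrE ?mulr_ge0 ?hnorm_ge0 ?(ltW M0).
rewrite -ler_sqr ?nnegrE ?mulr_ge0 ?hnorm_ge0 ?(ltW M0) //.
have M2 : 0 < M ^+ 2 by rewrite exprn_gt0.
by rewrite -(ler_pM2l M2); rewrite !exprMn in h1 *; lra.
Qed.

Lemma opnorm_bound H K (T : H -> K) x :
  linear T -> bounded_op T -> hnorm (T x) <= opnorm T * hnorm x.
Proof.
move=> lT [M [M0 bT]].
have [x0|x0] := eqVneq (hnorm x) 0.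
  by rewrite (hnorm_eq0 x0) linear_op0 // !hnorm0 mulr0.
have x_gt0 : 0 < hnorm x by rewrite lt_neqAle eq_sym x0 hnorm_ge0.
rewrite -ler_pdivrMr //; apply: ub_le_sup.
  exists M => _ [y y1 <-]; rewrite (le_trans (bT y)) // -[leRHS]mulr1.
  by rewrite ler_pM2l // -lecR hnormE.
exists ((hnorm x)^-1%:C%C *: x) => /=.
  rewrite -hnormE hnormZ ger0_norm ?invr_ge0 ?hnorm_ge0 // mulVf //.
rewrite linear_opZ // -[LHS]/(hnorm _) hnormZ ger0_norm ?invr_ge0 ?hnorm_ge0 //.
by rewrite mulrC.
Qed.

Lemma opnorm_le H K (T : H -> K) (M : R) :
  0 <= M -> (forall x, hnorm (T x) <= M * hnorm x) -> opnorm T <= M.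
Proof.
move=> M0 bT; apply: ge_sup.
  by exists (hnorm (T 0)); exists 0 => //=; rewrite normr0.
move=> _ [y y1 <-]; rewrite (le_trans (bT y)) // -[leRHS]mulr1.
by rewrite ler_wpM2l // -lecR hnormE.
Qed.

Lemma opnorm_ge0 H K (T : H -> K) :
  linear T -> bounded_op T -> 0 <= opnorm T.
Proof.
move=> lT [M [M0 bT]]; apply: (@le_trans _ _ (hnorm (T 0))); first exact: hnorm_ge0.
apply: ub_le_sup; last by exists 0 => //=; rewrite normr0.
exists M => _ [y y1 <-]; rewrite (le_trans (bT y)) // -[leRHS]mulr1.
by rewrite ler_pM2l // -lecR hnormE.
Qed.

End CompactOperators.

Section DirectSumOperators.
Context (R : realType).
Implicit Types H K : hilbertType R.

Definition dsum_op H K H' K' (T : H -> K) (S : H' -> K') :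
  hsum H H' -> hsum K K' := fun x => (T x.1, S x.2).

Lemma dsum_op_linear H K H' K' (T : H -> K) (S : H' -> K') :
  linear T -> linear S -> linear (dsum_op T S).
Proof.
move=> lT lS c x y.
by rewrite -[LHS]/(T (c *: x.1 + y.1), S (c *: x.2 + y.2)) lT lS.
Qed.

Lemma dsum_op_bound H K H' K' (T : H -> K) (S : H' -> K') (M : R) :
  0 <= M ->
  (forall x, hnorm (T x) <= M * hnorm x) ->
  (forall x, hnorm (S x) <= M * hnorm x) ->
  forall x, hnorm (dsum_op T S x) <= M * hnorm x.
Proof.
move=> M0 bT bS x.
rewrite -ler_sqr ?nnegrE ?mulr_ge0 ?hnorm_ge0 // exprMn.
have E (A B : hilbertType R) (z : hsum A B) :
    hnorm z ^+ 2 = hnorm z.1 ^+ 2 + hnorm z.2 ^+ 2.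
  apply: (@complexI R); rewrite rmorphD !rmorphXn /= !hnormE.
  exact: hsum_norm_sqr.
rewrite !E mulrDr -!exprMn lerD // ler_sqr ?nnegrE ?mulr_ge0 ?hnorm_ge0 //.
  exact: bT.
exact: bS.
Qed.

Lemma dsum_op_adjoint H K H' K' (T : H -> K) (S : H' -> K') T' S' :
  adjoint T T' -> adjoint S S' -> adjoint (dsum_op T S) (dsum_op T' S').
Proof.
move=> TT SS x y.
by rewrite -[LHS]/(dotp (T x.1) y.1 + dotp (S x.2) y.2) TT SS.
Qed.

Lemma dsum_op_positive H H' (T : H -> H) (S : H' -> H') :
  positive_op T -> positive_op S -> positive_op (dsum_op T S).
Proof.
move=> pT pS x; rewrite -[dotp _ _]/(dotp (T x.1) x.1 + dotp (S x.2) x.2).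
by rewrite addr_ge0.
Qed.

Lemma dsum_op_compact H K H' K' (T : H -> K) (S : H' -> K') :
  compact_op T -> compact_op S -> compact_op (dsum_op T S).
Proof.
move=> [lT cT] [lS cS]; split; first exact: dsum_op_linear.
pose f (z : K * K') : hsum K K' := z.
have cf : continuous f by move=> z; apply: hsum_cvg; [exact: cvg_fst|exact: cvg_snd].
apply: precompact_subset (precompact_continuous2 cf cT cS).
move=> _ [x x1 <-]; exists (T x.1, S x.2) => //; split=> /=.
- by exists x.1 => //; exact: le_trans (hsum_norm1 x) x1.
- by exists x.2 => //; exact: le_trans (hsum_norm2 x) x1.
Qed.

End DirectSumOperators.

Section UnitaryRepresentations.
Context (R : realType) (G : topologicalGroupType).

Definition separable_space (T : topologicalType) : Prop :=
  exists A : set T, countable A /\ dense A.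

Definition isometry_onto (H K : hilbertType R) (M : set K) (U : H -> K) : Prop :=
  [/\ linear U, isometry (@dotp R K) (@dotp R H) U & range U = M].

Definition unitary (H K : hilbertType R) (U : H -> K) : Prop :=
  isometry_onto [set: K] U.

Record unitary_rep := UnitaryRep {
  rep_space :> hilbertType R;
  rep_separable : separable_space rep_space;
  rep_act : G -> rep_space -> rep_space;
  rep_unitary : forall g, unitary (rep_act g);
  rep_act1 : rep_act 1%g = id;
  rep_actM : forall g h, rep_act (g * h)%g = rep_act g \o rep_act h;
  (* continuity in the strong operator topology *)
  rep_continuous : forall x, continuous (rep_act ^~ x) }.

Definition subrep (nu : unitary_rep) (M : set nu) : Prop :=
  [/\ closed M, M 0, forall c x y, M x -> M y -> M (c *: x + y) &
      forall g x, M x -> M (rep_act g x)].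

Definition equivariant (mu nu : unitary_rep) (T : mu -> nu) : Prop :=
  forall g x, T (rep_act g x) = rep_act g (T x).

Definition rep_equiv (mu nu : unitary_rep) : Prop :=
  exists U : mu -> nu, unitary U /\ equivariant U.

Definition rep_le (mu nu : unitary_rep) : Prop :=
  exists M : set nu, subrep M /\
    exists U : mu -> nu, isometry_onto M U /\ equivariant U.

Lemma separable_hsum (H K : hilbertType R) :
  separable_space H -> separable_space K -> separable_space (hsum H K).
Proof.
move=> [A [cA dA]] [B [cB dB]]; exists (A `*` B : set (hsum H K)); split.
  exact: countableX.
move=> O [x Ox] oO.
have /nbhs_ballP[e /= e0 eO] : nbhs x O by exact: open_nbhs_nbhs.
have e2 : 0 < e / 2 by rewrite divr_gt0.
have dense_ball (L : hilbertType R) (D : set L) (z : L) : dense D ->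
    exists2 y, D y & `|z - y| < e / 2.
  move=> dD; have [] := dD (ball z (e / 2))°.
  - by exists z; apply: nbhsx_ballx.
  - exact: open_interior.
  - move=> y [/interior_subset + Dy]; rewrite -ball_normE /= => zy.
    by exists y.
have [a Aa xa] := dense_ball _ _ x.1 dA.
have [b Bb xb] := dense_ball _ _ x.2 dB.
exists ((a, b) : hsum H K); split; last by split.
apply: eO; rewrite -ball_normE /= (le_lt_trans (hsum_norm_le _)) //=.
by rewrite [ltRHS]splitr ltrD.
Qed.

Lemma dsum_op_unitary (H K H' K' : hilbertType R) (U : H -> K) (V : H' -> K') :
  unitary U -> unitary V -> unitary (dsum_op U V).
Proof.
move=> [lU iU sU] [lV iV sV]; split; first exact: dsum_op_linear.
- move=> x y; rewrite -[LHS]/(dotp (U x.1) (U y.1) + dotp (V x.2) (V y.2)).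
  by rewrite iU iV.
- apply/seteqP; split=> // -[y1 y2] _.
  have : range U y1 by rewrite sU.
  have : range V y2 by rewrite sV.
  by move=> [x2 _ <-] [x1 _ <-]; exists ((x1, x2) : hsum H H').
Qed.

Section RepSum.
Context (mu nu : unitary_rep).

Definition rep_sum_act (g : G) : hsum mu nu -> hsum mu nu :=
  dsum_op (rep_act g) (rep_act g).

Lemma rep_sum_unitary g : unitary (rep_sum_act g).
Proof. by apply: dsum_op_unitary; exact: rep_unitary. Qed.

Lemma rep_sum_act1 : rep_sum_act 1%g = id.
Proof. by apply/funext => -[x y]; rewrite /rep_sum_act /dsum_op !rep_act1. Qed.

Lemma rep_sum_actM g h : rep_sum_act (g * h)%g = rep_sum_act g \o rep_sum_act h.
Proof. by apply/funext => -[x y]; rewrite /rep_sum_act /dsum_op !rep_actM. Qed.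

Lemma rep_sum_continuous x : continuous (rep_sum_act ^~ x).
Proof. by move=> g; apply: hsum_cvg; exact: rep_continuous. Qed.

Definition rep_sum : unitary_rep :=
  UnitaryRep (separable_hsum (@rep_separable mu) (@rep_separable nu))
    rep_sum_unitary rep_sum_act1 rep_sum_actM rep_sum_continuous.

End RepSum.

Lemma rep_equiv_refl mu : rep_equiv mu mu.
Proof. by exists id; split=> //; split=> //; apply/seteqP; split=> // x _; exists x. Qed.

Lemma rep_equiv_trans nu mu rho :
  rep_equiv mu nu -> rep_equiv nu rho -> rep_equiv mu rho.
Proof.
move=> [U [[lU iU sU] eU]] [V [[lV iV sV] eV]]; exists (V \o U); split.
  split.
  - by move=> c x y /=; rewrite lU lV.
  - by move=> x y /=; rewrite iV iU.
  - apply/seteqP; split=> // z _; have : range V z by rewrite sV.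
    move=> [y _ <-]; have : range U y by rewrite sU.
    by move=> [x _ <-]; exists x.
by move=> g x /=; rewrite eU eV.
Qed.

Lemma isometry_inj (H K : hilbertType R) (U : H -> K) :
  linear U -> isometry (@dotp R K) (@dotp R H) U -> injective U.
Proof.
move=> lU iU x y Uxy; apply/eqP; rewrite -subr_eq0; apply/eqP/dotp_eq0P => z.
by rewrite -iU linear_opD // linear_opN // Uxy subrr linear0l.
Qed.

Lemma rep_equiv_sym mu nu : rep_equiv mu nu -> rep_equiv nu mu.
Proof.
move=> [U [[lU iU sU] eU]].
have /choice[V VK] : forall y, exists x, U x = y.
  by move=> y; have : range U y; [rewrite sU|move=> [x _ <-]; exists x].
have Ui := isometry_inj lU iU.
exists V; split; first split.
- by move=> c x y; apply: Ui; rewrite lU !VK.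
- by move=> x y; rewrite -iU !VK.
- by apply/seteqP; split=> // x _; exists (U x) => //; apply: Ui; rewrite VK.
- by move=> g x; apply: Ui; rewrite eU !VK.
Qed.

Lemma rep_equiv_sum mu mu' nu nu' : rep_equiv mu mu' -> rep_equiv nu nu' ->
  rep_equiv (rep_sum mu nu) (rep_sum mu' nu').
Proof.
move=> [U [uU eU]] [V [uV eV]]; exists (dsum_op U V); split.
  exact: dsum_op_unitary.
by move=> g x; rewrite /= /rep_sum_act /dsum_op /= eU eV.
Qed.

Lemma rep_le_equiv mu mu' nu nu' : rep_equiv mu' mu -> rep_equiv nu nu' ->
  rep_le mu nu -> rep_le mu' nu'.
Proof.
move=> [U [[lU iU sU] eU]] [V [[lV iV sV] eV]] [M [[clM M0 linM invM]]].
move=> [W [[lW iW sW] eW]].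
have Vi := isometry_inj lV iV.
have [V' VK] : exists V' : nu' -> nu, cancel V' V.
  suff /choice[V' ?] : forall y, exists x, V x = y by exists V'.
  by move=> y; have : range V y; [rewrite sV|move=> [x _ <-]; exists x].
have KV : cancel V V' by move=> x; apply: Vi; rewrite VK.
have V'M : V @` M = V' @^-1` M.
  apply/seteqP; split=> [_ [x Mx <-]|y My] /=; first by rewrite KV.
  by exists (V' y) => //; rewrite VK.
exists (V @` M); split; last first.
  exists (V \o W \o U); split; first split.
  - by move=> c x y /=; rewrite lU lW lV.
  - by move=> x y /=; rewrite iV iW iU.
  - rewrite -sW; apply/seteqP; split=> [_ [x _ <-]|_ [_ [x _ <-] <-]].
      by exists (W (U x)) => //; exists (U x).
    by have : range U x by [rewrite sU]; move=> [z _ <-]; exists z.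
  - by move=> g x /=; rewrite eU eW eV.
have lV' : linear V' by move=> c x y; apply: Vi; rewrite lV !VK.
split.
- rewrite V'M; apply: (preimage_closed _ clM) => x _.
  apply: bounded_linear_op_continuous => //; exists 1; split=> // y.
  rewrite mul1r -ler_sqr ?nnegrE ?hnorm_ge0 // -!rdot_norm /rdot.
  by rewrite -iV VK.
- by exists 0 => //; rewrite linear_op0.
- move=> c _ _ [x Mx <-] [y My <-]; exists (c *: x + y); first exact: linM.
  by rewrite lV.
- by move=> g _ [x Mx <-]; exists (rep_act g x); [exact: invM|rewrite eV].
Qed.

Definition Cu : Type := quotient rep_equiv.

Definition Cu_class (mu : unitary_rep) : Cu := class_of rep_equiv mu.

Lemma Cu_eqP mu nu : Cu_class mu = Cu_class nu <-> rep_equiv mu nu.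
Proof.
apply: class_ofP.
- exact: rep_equiv_refl.
- exact: rep_equiv_sym.
- by move=> x y z; exact: rep_equiv_trans.
Qed.

(* Independence of the representatives is Cu_addE and Cu_leE below; likewise
   for CuG. *)
Definition Cu_add (x y : Cu) : Cu := Cu_class (rep_sum (repr_of x) (repr_of y)).

Definition Cu_le (x y : Cu) : Prop := rep_le (repr_of x) (repr_of y).

Lemma rep_equiv_repr mu : rep_equiv (repr_of (Cu_class mu)) mu.
Proof. by apply/Cu_eqP; rewrite /Cu_class repr_ofK. Qed.

Lemma Cu_addE mu nu : Cu_add (Cu_class mu) (Cu_class nu) = Cu_class (rep_sum mu nu).
Proof. by apply/Cu_eqP/rep_equiv_sum; exact: rep_equiv_repr. Qed.

Lemma Cu_leE mu nu : Cu_le (Cu_class mu) (Cu_class nu) <-> rep_le mu nu.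
Proof.
have rr := rep_equiv_repr.
by split; apply: rep_le_equiv => //; apply: rep_equiv_sym.
Qed.

End UnitaryRepresentations.
Section EquivariantCuntz.
Context (R : realType) (G : topologicalGroupType).
Local Notation unitary_rep := (unitary_rep R G).
Implicit Types mu nu rho : unitary_rep.

Definition fixed_op nu mu (T : nu -> mu) : Prop :=
  forall g : G, rep_act g \o T \o rep_act (g^-1)%g = T.

(* K(H_nu, H_mu)^G *)
Definition compact_fixed nu mu (T : nu -> mu) : Prop :=
  compact_op T /\ fixed_op T.

(* The positive elements of the fixed-point algebra of K(H_mu). *)
Record fixed_positive mu := FixedPositive {
  fixed_positive_op :> mu -> mu;
  fixed_positiveK : compact_fixed fixed_positive_op;
  fixed_positive_ge0 : positive_op fixed_positive_op }.

Definition cuntz_le mu nu (a : fixed_positive mu) (b : fixed_positive nu) : Prop :=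
  exists d : nat -> nu -> mu, exists ds : nat -> mu -> nu,
    [/\ forall n, compact_fixed (d n), forall n, adjoint (d n) (ds n) &
     (fun n => opnorm (d n \o b \o ds n \- a)) @ \oo --> (0 : R)].

Definition cuntz_elt : Type := {mu : unitary_rep & fixed_positive mu}.

Definition cuntz_elt_le (x y : cuntz_elt) : Prop :=
  cuntz_le (projT2 x) (projT2 y).

Definition cuntz_equiv (x y : cuntz_elt) : Prop :=
  cuntz_elt_le x y /\ cuntz_elt_le y x.

Lemma compact_fixed_sum nu nu' mu mu' (T : nu -> mu) (T' : nu' -> mu') :
  compact_fixed T -> compact_fixed T' ->
  @compact_fixed (rep_sum nu nu') (rep_sum mu mu') (dsum_op T T').
Proof.
move=> [cT fT] [cT' fT']; split; first exact: dsum_op_compact.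
move=> g; apply/funext => -[x y]; rewrite /= /rep_sum_act /dsum_op /=.
by rewrite -{2}(fT g) -{2}(fT' g).
Qed.

Definition fixed_positive_sum mu nu (a : fixed_positive mu)
    (b : fixed_positive nu) : fixed_positive (rep_sum mu nu) :=
  @FixedPositive (rep_sum mu nu) (dsum_op a b)
    (compact_fixed_sum (fixed_positiveK a) (fixed_positiveK b))
    (dsum_op_positive (@fixed_positive_ge0 _ a) (@fixed_positive_ge0 _ b)).

Definition cuntz_sum (x y : cuntz_elt) : cuntz_elt :=
  existT _ _ (fixed_positive_sum (projT2 x) (projT2 y)).

Lemma comp_sub_linear (H K : hilbertType R) (d : K -> H) b (ds : H -> K) a :
  linear d -> linear b -> linear ds -> linear a ->
  linear (d \o b \o ds \- a).
Proof.
move=> ld lb lds la c x y.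
rewrite -[LHS]/(d (b (ds (c *: x + y))) - a (c *: x + y)).
rewrite lds lb ld la -[X in _ = _ *: X + _]/(d (b (ds x)) - a x).
by rewrite -[X in _ = _ + X]/(d (b (ds y)) - a y) scalerBr opprD addrACA.
Qed.

Lemma cuntz_leP mu nu (a : fixed_positive mu) (b : fixed_positive nu) :
  cuntz_le a b <-> forall e : R, 0 < e -> exists d ds,
    [/\ @compact_fixed nu mu d, adjoint d ds &
     forall x, hnorm (d (b (ds x)) - a x) <= e * hnorm x].
Proof.
have [[[la ca] fa] [[lb cb] fb]] := (fixed_positiveK a, fixed_positiveK b).
split=> [[d [ds [Kd dds dcv]]] e e0|H].
  have [n _ /= nP] : \forall n \near \oo, opnorm (d n \o b \o ds n \- a) < e.
    move/cvgrPdist_lt : dcv => /(_ _ e0); apply: filterS => n.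
    by rewrite sub0r normrN; apply: le_lt_trans; rewrite ler_norm.
  exists (d n), (ds n); split=> // x.
  have [[ld cd] fd] := Kd n.
  apply: le_trans (_ : opnorm (d n \o b \o ds n \- a) * hnorm x <= _).
    apply: (@opnorm_bound _ _ _ (d n \o b \o ds n \- a)).
      by apply: comp_sub_linear => //; exact: adjoint_linear (dds n).
    apply: bounded_op_add; last by apply: bounded_op_opp; exact: compact_op_bounded.
    have bd : bounded_op (d n) by exact: compact_op_bounded.
    apply: bounded_op_comp; last exact: adjoint_bounded (dds n) bd.
    by apply: bounded_op_comp => //; exact: compact_op_bounded.
  by rewrite ler_wpM2r ?hnorm_ge0 // ltW //; apply: nP => /=.
have /choice[D DP] : forall n : nat, exists p : (nu -> mu) * (mu -> nu),
    [/\ compact_fixed p.1, adjoint p.1 p.2 &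
     forall x, hnorm (p.1 (b (p.2 x)) - a x) <= n.+1%:R^-1 * hnorm x].
  by move=> n; have [//|d [ds ?]] := H n.+1%:R^-1; exists (d, ds).
exists (fun n => (D n).1), (fun n => (D n).2); split.
- by move=> n; have [] := DP n.
- by move=> n; have [] := DP n.
apply: (@squeeze_cvgr _ _ _ _ (fun=> 0) (@harmonic R)); last 2 first.
- exact: cvg_cst.
- exact: cvg_harmonic.
near=> n; have [[[ld cd] fd] dds bD] := DP n; apply/andP; split.
- apply: opnorm_ge0.
    by apply: comp_sub_linear => //; exact: adjoint_linear dds.
  by exists n.+1%:R^-1; split=> //.
- apply: (@opnorm_le _ _ _ ((D n).1 \o b \o (D n).2 \- a)).
    by rewrite /harmonic /= invr_ge0.
  exact: bD.
Unshelve. all: by end_near. Qed.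

Lemma fixed_opE nu mu (T : nu -> mu) :
  fixed_op T -> forall g x, rep_act g (T x) = T (rep_act g x).
Proof.
move=> fT g x; rewrite -[in RHS](fT g) /= -[in LHS](_ : rep_act (g^-1)%g (rep_act g x) = x) //.
by rewrite -[LHS]/((rep_act g^-1%g \o rep_act g) x) -rep_actM mulVg rep_act1.
Qed.

Lemma fixed_op_comp nu mu rho (T : nu -> mu) (S : rho -> nu) :
  fixed_op T -> fixed_op S -> fixed_op (T \o S).
Proof.
move=> fT fS g; apply/funext => x /=.
rewrite fixed_opE // fixed_opE //.
by rewrite -[X in T (S X)]/((rep_act g \o rep_act g^-1%g) x) -rep_actM mulgV rep_act1.
Qed.

Lemma cuntz_le_trans mu nu rho (b : fixed_positive nu)
    (a : fixed_positive mu) (c : fixed_positive rho) :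
  cuntz_le a b -> cuntz_le b c -> cuntz_le a c.
Proof.
move=> /cuntz_leP ab /cuntz_leP bc; apply/cuntz_leP => e e0.
have [|d [ds [[[ld cd] fd] dds dP]]] := ab (e / 2); first by rewrite divr_gt0.
have cd' : compact_op d by [].
have [M [M0 bd]] := compact_op_bounded cd'.
have [N [N0 bds]] := adjoint_bounded dds (compact_op_bounded cd').
have MN0 : 0 < M * N by rewrite mulr_gt0.
have [|f [fs [[cf ff] ffs fP]]] := bc (e / 2 / (M * N)).
  by rewrite !divr_gt0.
have [lf _] := cf.
exists (d \o f), (fs \o ds); split.
- split; first by apply: compact_op_comp => //; exact: compact_op_bounded.
  exact: fixed_op_comp.
- by move=> x y /=; rewrite dds ffs.
move=> x /=.
rewrite -(subrK (d (b (ds x))) (d (f _))) -addrA (le_trans (hnormD _ _)) //.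
rewrite [e]splitr mulrDl lerD // -linear_opN // -linear_opD //.
rewrite (le_trans (bd _)) // (le_trans (ler_wpM2l (ltW M0) (fP _))) //.
rewrite mulrA.
apply: (@le_trans _ _ (M * (e / 2 / (M * N)) * (N * hnorm x))).
  by rewrite ler_wpM2l // mulr_ge0 ?(ltW M0) // ltW // !divr_gt0.
rewrite mulrA le_eqVlt; apply/orP; left; apply/eqP.
by field; rewrite !gt_eqF.
Qed.

Lemma cuntz_le_sum mu nu mu' nu' (a : fixed_positive mu) (b : fixed_positive nu)
    (a' : fixed_positive mu') (b' : fixed_positive nu') :
  cuntz_le a b -> cuntz_le a' b' ->
  cuntz_le (fixed_positive_sum a a') (fixed_positive_sum b b').
Proof.
move=> /cuntz_leP ab /cuntz_leP ab'; apply/cuntz_leP => e e0.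
have [//|d [ds [Kd dds dP]]] := ab e.
have [//|d' [ds' [Kd' dds' dP']]] := ab' e.
exists (dsum_op d d'), (dsum_op ds ds'); split.
- exact: compact_fixed_sum.
- exact: dsum_op_adjoint.
apply: (@dsum_op_bound _ _ _ _ _ (fun x => d (b (ds x)) - a x)
  (fun x => d' (b' (ds' x)) - a' x)) => //.
exact: ltW.
Qed.

Lemma fixed_opP nu mu (T : nu -> mu) :
  (forall g x, rep_act g (T x) = T (rep_act g x)) -> fixed_op T.
Proof.
move=> TE g; apply/funext => x /=; rewrite TE.
by rewrite -[X in T X]/((rep_act g \o rep_act g^-1%g) x) -rep_actM mulgV rep_act1.
Qed.

Lemma positive_op_adjoint (H : hilbertType R) (T : H -> H) :
  linear T -> positive_op T -> adjoint T T.
Proof.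
move=> lT pT x y.
have Treal z : Num.conj (dotp (T z) z) = dotp (T z) z.
  by apply/CrealP/ger0_real/pT.
have := Treal (x + y); have := Treal (x + 'i *: y).
rewrite !(linear_opD _ _ lT) !(linear_opZ _ _ lT) !linearDl !linearDr /=.
rewrite !linearZl_LR !linearZr_LR /=.
rewrite -[_ *: (_ * _)]/(_ * (_ * _)) conjCi.
have ii (z : R[i]) : - 'i * ('i * z) = z.
  by rewrite mulNr mulrA -expr2 sqrCi mulN1r opprK.
rewrite ii !rmorphD !rmorphM /= !Treal rmorphN /= conjCi opprK (dotpC x).
set A := dotp (T x) y; set B := dotp (T y) x.
set X := dotp (T x) x; set Y := dotp (T y) y.
move=> h1 h2.
have i0 : 'i != 0 :> R[i] by rewrite neq0Ci.
have h2' : Num.conj A + Num.conj B = A + B.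
  by apply: (addrI X); apply: (addIr Y); rewrite !addrA in h2 *; exact: h2.
have h1' : Num.conj A - Num.conj B = B - A.
  apply: (mulfI i0); apply: (addrI X); apply: (addIr Y).
  transitivity (X + 'i * Num.conj A + (- 'i * Num.conj B + Y)); first by ring.
  by rewrite h1; ring.
have two0 : 2 != 0 :> R[i] by rewrite pnatr_eq0.
apply: (mulfI two0).
have -> : 2 * A = Num.conj (2 * Num.conj A) by rewrite rmorphM /= conjCK conjC_nat.
have -> : 2 * Num.conj A = 2 * B.
  have -> : 2 * Num.conj A = (Num.conj A + Num.conj B) + (Num.conj A - Num.conj B) by ring.
  rewrite h2' h1'; ring.
by rewrite rmorphM /= conjC_nat.
Qed.

(* For 0 <= b <= 1 and q = 1 - b, the operators b q^n tend to 0 in norm. *)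
Lemma positive_op_iter (H : hilbertType R) (b : H -> H) :
  linear b -> positive_op b -> (forall x, hnorm (b x) <= hnorm x) ->
  forall n x, n%:R * hnorm (b (iter n (fun y => y - b y) x)) ^+ 2 +
    hnorm (iter n (fun y => y - b y) x) ^+ 2 <= hnorm x ^+ 2.
Proof.
move=> lb pb b1; have bb := positive_op_adjoint lb pb.
have b2 x : hnorm (b x) ^+ 2 <= hnorm x ^+ 2 by rewrite ler_sqr ?nnegrE ?hnorm_ge0.
have simp := (rdotDl, rdotDr, rdotNl, rdotNr).
have rdot_le y : rdot (b y) y <= hnorm y ^+ 2.
  have : 0 <= hnorm (b y - y) ^+ 2 by rewrite exprn_ge0 ?hnorm_ge0.
  rewrite -rdot_norm !simp (rdotC y) !rdot_norm; have := b2 y; lra.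
have le_rdot x : hnorm (b x) ^+ 2 <= rdot (b x) x.
  have : 0 <= rdot (b (x - b x)) (x - b x).
    by have := pb (x - b x); rewrite lecE => /andP[].
  rewrite (linear_opD _ _ lb) (linear_opN _ lb) !simp.
  rewrite (adjoint_rdot (b x) x bb) !rdot_norm.
  have := rdot_le (b x); lra.
have qle x : hnorm (x - b x) ^+ 2 <= hnorm x ^+ 2 - hnorm (b x) ^+ 2.
  rewrite -rdot_norm !simp (rdotC x (b x)) !rdot_norm.
  have := le_rdot x; lra.
elim=> [|n IH] x; first by rewrite mul0r add0r.
apply: le_trans (IH x); rewrite iterS; set y := iter n _ x.
have h1 : hnorm (b (y - b y)) ^+ 2 <= hnorm (b y) ^+ 2.
  rewrite (linear_opD _ _ lb) (linear_opN _ lb).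
  have := qle (b y); have := exprn_ge0 2 (hnorm_ge0 (b (b y))); lra.
have h2 : n.+1%:R * hnorm (b (y - b y)) ^+ 2 <= n.+1%:R * hnorm (b y) ^+ 2.
  by rewrite ler_wpM2l.
move: h2; rewrite -[n.+1]addn1 natrD => h2; have := qle y; lra.
Qed.

Lemma cuntz_le_refl mu (a : fixed_positive mu) : cuntz_le a a.
Proof.
have [[[la pra] fa] pa] := (fixed_positiveK a, @fixed_positive_ge0 _ a).
have ca : compact_op a by [].
have [M [M0 bM]] := compact_op_bounded ca.
pose b (x : mu) : mu := M^-1%:C%C *: a x.
have Mc0 : M%:C%C != 0 :> R[i].
  by apply/negP => /eqP/complexI M00; rewrite M00 ltxx in M0.
have ab x : a x = M%:C%C *: b x.
  rewrite /b scalerA -rmorphM /= mulfV ?gt_eqF //.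
  by rewrite -[_%:C%C]/(1 : R[i]) scale1r.
have lb : linear b.
  by move=> c x y; rewrite /b la scalerDr !scalerA (mulrC c).
have b1 x : hnorm (b x) <= hnorm x.
  rewrite hnormZ ger0_norm ?invr_ge0 ?(ltW M0) //.
  by rewrite mulrC ler_pdivrMr // mulrC.
have pb : positive_op b.
  move=> x; rewrite linearZl_LR /= mulr_ge0 //.
  by rewrite -[X in X <= _]/((0 : R)%:C%C) lecR invr_ge0 ltW.
have cb : compact_op b.
  have -> : (b : mu -> mu) = a \o (fun x => M^-1%:C%C *: x).
    by apply/funext => x; rewrite /b /= (linear_opZ _ _ la).
  apply: compact_op_comp => //.
    by move=> c x y /=; rewrite scalerDr !scalerA (mulrC c).
  exists (M^-1); split; first by rewrite invr_gt0.
  by move=> x; rewrite hnormZ ger0_norm ?invr_ge0 ?(ltW M0).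
have eb (g : G) x : rep_act g (b x) = b (rep_act g x).
  have [lg _ _] := rep_unitary mu g.
  by rewrite /b (linear_opZ _ _ lg) (fixed_opE fa).
pose q (y : mu) : mu := y - b y.
have lq n : linear (iter n q).
  elim: n => [//|n IH] c x y; rewrite !iterS IH /q lb scalerBr opprD addrACA.
  by [].
have q1 n x : hnorm (iter n q x) <= hnorm x.
  rewrite -ler_sqr ?nnegrE ?hnorm_ge0 //.
  apply: le_trans (positive_op_iter lb pb b1 n x).
  by rewrite lerDr mulr_ge0 // exprn_ge0 // hnorm_ge0.
have bb := positive_op_adjoint lb pb.
have qq n : adjoint (iter n q) (iter n q).
  elim: n => [//|n IH] x y; rewrite iterS iterSr -IH /q.
  by rewrite linearBl linearBr; congr (_ - _); exact: bb.
have qb n x : iter n q (b x) = b (iter n q x).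
  elim: n => [//|n IH]; rewrite !iterS IH /q.
  by rewrite (linear_opD _ _ lb) (linear_opN _ lb).
have qa n x : iter n q (a x) = a (iter n q x).
  by rewrite !ab (linear_opZ _ _ (lq n)) qb.
have eq_ n (g : G) x : rep_act g (iter n q x) = iter n q (rep_act g x).
  elim: n => [//|n IH]; rewrite !iterS /q.
  have [lg _ _] := rep_unitary mu g.
  by rewrite (linear_opD _ _ lg) (linear_opN _ lg) eb IH.
pose p n (x : mu) : mu := x - iter n q x.
have cp n : compact_op (p n).
  elim: n => [|n IH].
    have -> : p 0%N = b \o (fun=> 0).
      by apply/funext => x; rewrite /p /= subrr (linear_op0 lb).
    apply: compact_op_comp => //; first by move=> c x y; rewrite scaler0 addr0.
    by exists 1; split=> // x; rewrite hnorm0 mul1r hnorm_ge0.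
  have -> : p n.+1 = p n + (b \o iter n q).
    apply/funext => x; rewrite [RHS]/(x - iter n q x + b (iter n q x)).
    by rewrite /p iterS /q opprB addrA addrAC.
  apply: compact_op_add => //; apply: compact_op_comp => //.
  by exists 1; split=> // x; rewrite mul1r.
apply/cuntz_leP => e e0.
have [n nP] : exists n : nat, (3 * M / e) ^+ 2 <= n%:R.
  exists (Num.truncn ((3 * M / e) ^+ 2)).+1; apply/ltW.
  exact: truncnS_gt.
exists (p n), (p n); split.
- split=> //; apply: fixed_opP => g x.
  have [lg _ _] := rep_unitary mu g.
  by rewrite /p (linear_opD _ _ lg) (linear_opN _ lg) eq_.
- by move=> x y; rewrite /p linearBl linearBr; congr (_ - _); exact: qq.
move=> x.
set t := hnorm (b (iter n q x)).
have aqE : hnorm (a (iter n q x)) = M * t.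
  by rewrite ab hnormZ ger0_norm // ltW.
have -> : p n (a (p n x)) - a x =
    iter n q (a (iter n q x)) - a (iter n q x) - a (iter n q x).
  rewrite /p (linear_opD _ _ la) (linear_opN _ la).
  rewrite (linear_opD _ _ (lq n)) (linear_opN _ (lq n)) qa.
  rewrite opprB; set u := a x; set v := a (iter n q x); set w := iter n q v.
  by rewrite addrAC (addrAC u) subrr add0r addrC.
have t3 : hnorm (iter n q (a (iter n q x)) - a (iter n q x) - a (iter n q x)) <=
    3 * M * t.
  rewrite (le_trans (hnormD _ _)) // (@le_trans _ _ ((M * t + M * t) + M * t)) //.
    rewrite hnormN aqE lerD2r (le_trans (hnormD _ _)) // hnormN aqE lerD2r.
    by rewrite (le_trans (q1 _ _)) // aqE.
  by rewrite le_eqVlt; apply/orP; left; apply/eqP; ring.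
apply: le_trans t3 _.
have t0 : 0 <= t by exact: hnorm_ge0.
rewrite -ler_sqr ?nnegrE ?mulr_ge0 ?hnorm_ge0 ?(ltW M0) ?(ltW e0) //.
have := positive_op_iter lb pb b1 n x; rewrite -/t => nt.
have nt' : n%:R * t ^+ 2 <= hnorm x ^+ 2.
  by apply: le_trans nt; rewrite lerDl exprn_ge0 // hnorm_ge0.
rewrite [leRHS]exprMn; apply: (@le_trans _ _ (e ^+ 2 * (n%:R * t ^+ 2))); last first.
  by rewrite ler_wpM2l // exprn_ge0 // ltW.
have -> : (3 * M * t) ^+ 2 = e ^+ 2 * ((3 * M / e) ^+ 2 * t ^+ 2).
  by field; rewrite gt_eqF.
by rewrite ler_wpM2l ?exprn_ge0 ?(ltW e0) // ler_wpM2r // exprn_ge0.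
Qed.

Lemma cuntz_equiv_refl x : cuntz_equiv x x.
Proof. by split; exact: cuntz_le_refl. Qed.

Lemma cuntz_equiv_sym x y : cuntz_equiv x y -> cuntz_equiv y x.
Proof. by case. Qed.

Lemma cuntz_equiv_trans x y z :
  cuntz_equiv x y -> cuntz_equiv y z -> cuntz_equiv x z.
Proof.
move=> [xy yx] [yz zy]; split; first exact: cuntz_le_trans xy yz.
exact: cuntz_le_trans zy yx.
Qed.

(* The semigroup Cu^G(C), C with the trivial action. *)
Definition CuG : Type := quotient cuntz_equiv.

Definition CuG_class mu (a : fixed_positive mu) : CuG :=
  class_of cuntz_equiv (existT _ mu a).

Definition CuG_add (x y : CuG) : CuG :=
  class_of cuntz_equiv (cuntz_sum (repr_of x) (repr_of y)).

Definition CuG_le (x y : CuG) : Prop := cuntz_elt_le (repr_of x) (repr_of y).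

Lemma CuG_eqP mu nu (a : fixed_positive mu) (b : fixed_positive nu) :
  CuG_class a = CuG_class b <-> cuntz_le a b /\ cuntz_le b a.
Proof.
apply: (class_ofP cuntz_equiv_refl cuntz_equiv_sym cuntz_equiv_trans).
Qed.

Lemma cuntz_equiv_repr x : cuntz_equiv (repr_of (class_of cuntz_equiv x)) x.
Proof.
apply/(class_ofP cuntz_equiv_refl cuntz_equiv_sym cuntz_equiv_trans).
by rewrite repr_ofK.
Qed.

Lemma CuG_addE mu nu (a : fixed_positive mu) (b : fixed_positive nu) :
  CuG_add (CuG_class a) (CuG_class b) = CuG_class (fixed_positive_sum a b).
Proof.
apply/(class_ofP cuntz_equiv_refl cuntz_equiv_sym cuntz_equiv_trans).
have [a1 a2] := cuntz_equiv_repr (existT _ mu a).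
have [b1 b2] := cuntz_equiv_repr (existT _ nu b).
by split; apply: cuntz_le_sum.
Qed.

Lemma CuG_leE mu nu (a : fixed_positive mu) (b : fixed_positive nu) :
  CuG_le (CuG_class a) (CuG_class b) <-> cuntz_le a b.
Proof.
have [a1 a2] := cuntz_equiv_repr (existT _ mu a).
have [b1 b2] := cuntz_equiv_repr (existT _ nu b).
split=> ab; first exact: cuntz_le_trans (cuntz_le_trans a2 ab) b1.
exact: cuntz_le_trans (cuntz_le_trans a1 ab) b2.
Qed.

End EquivariantCuntz.

(* Main.v *)
(* Everything reduces to: for injective a on mu and b on nu, mu <= nu iff
   a is Cuntz-below b; the existence of the invariant strictly positive
   operators s mu stands in for averaging over G.

   If U embeds mu in nu, then d = a^(1/2) U^* b^(-1/2), suitably cut off,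
   satisfies d b d^* ~ a. Conversely, if d b d^* ~ a, then b d^* is injective on
   a given finite-dimensional spectral subspace of a, and its polar part embeds
   that subspace in nu. These embeddings need not be compatible, but when u
   embeds a subspace F and L is injective on a larger one F', then u + t L is
   injective on F' for generic small t, and its polar part is close to u on F.
   Hence the embeddings can be chosen to converge on the dense union.

   Antisymmetry of <= on representations is the Schroeder-Bernstein theorem for
   unitary representations, which gives injectivity of the map; a positive a on
   mu is Cuntz-equivalent to any injective one on (ker a)^perp, which gives
   surjectivity. *)
From HB Require Import structures.
From mathcomp Require Import all_boot all_order all_algebra.
From mathcomp Require Import finmap complex ring lra.
From mathcomp Require Import all_classical all_reals all_analysis.
Require Import Defs.

Set Implicit Arguments.
Unset Strict Implicit.
Unset Printing Implicit Defensive.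

Import Order.TTheory GRing.Theory Num.Theory.
Import numFieldNormedType.Exports.

Local Open Scope classical_set_scope.
Local Open Scope ring_scope.

(** * Hilbert space geometry *)

(** Infinite-dimensional square roots and the unbounded b^(-1/2) are avoided by working on the span
    of the eigenvectors of a compact positive operator with eigenvalue at least some eps > 0. This
    span is finite-dimensional and, for an invariant operator, invariant under G, so every function
    of the operator cut off there has finite rank and is equivariant. Injectivity does two different
    jobs: that of a makes these spans exhaust mu as eps tends to 0, and that of b makes every vector
    of nu orthogonal to ker b. The obstacle in the converse is that the relation between a and b is
    tested one precision at a time, and each test says something about a single span only. An exact
    extension of an embedding from F to F' would have to place the rest of F' in the orthogonal
    complement of the image of F, where the test gives no direct information. Allowing the old
    embedding to move by an arbitrarily small amount removes this difficulty, and summable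
    displacements still converge. Additivity costs nothing more: a direct sum of injective operators
    is injective, so it is compared with the chosen operator on the same representation. *)

Section HilbertSpaces.
Context (R : realType).
Implicit Types H K : hilbertType R.

Lemma dotDl H (x y z : H) : dotp (x + y) z = dotp x z + dotp y z.
Proof. exact: linearDl. Qed.

Lemma dotNl H (x z : H) : dotp (- x) z = - dotp x z.
Proof. exact: linearNl. Qed.

Lemma dotBl H (x y z : H) : dotp (x - y) z = dotp x z - dotp y z.
Proof. by rewrite dotDl dotNl. Qed.

Lemma dotZl H c (x z : H) : dotp (c *: x) z = c * dotp x z.
Proof. exact: linearZl_LR. Qed.

Lemma dot0l H (z : H) : dotp 0 z = 0.
Proof. exact: linear0l. Qed.

Lemma dotDr H (x y z : H) : dotp z (x + y) = dotp z x + dotp z y.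
Proof. exact: linearDr. Qed.

Lemma dotNr H (x z : H) : dotp z (- x) = - dotp z x.
Proof. exact: linearNr. Qed.

Lemma dotBr H (x y z : H) : dotp z (x - y) = dotp z x - dotp z y.
Proof. by rewrite dotDr dotNr. Qed.

Lemma dotZr H c (x z : H) : dotp z (c *: x) = Num.conj c * dotp z x.
Proof. by rewrite linearZr_LR. Qed.

Lemma dot0r H (z : H) : dotp z 0 = 0.
Proof. exact: linear0r. Qed.

Lemma dot_suml H I (r : seq I) (P : pred I) (f : I -> H) z :
  dotp (\sum_(i <- r | P i) f i) z = \sum_(i <- r | P i) dotp (f i) z.
Proof. by elim/big_rec2: _ => [|i a b _ <-]; rewrite ?dot0l // dotDl. Qed.

Lemma dot_sumr H I (r : seq I) (P : pred I) (f : I -> H) z :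
  dotp z (\sum_(i <- r | P i) f i) = \sum_(i <- r | P i) dotp z (f i).
Proof. by elim/big_rec2: _ => [|i a b _ <-]; rewrite ?dot0r // dotDr. Qed.

Lemma dotp_hnorm H (x : H) : dotp x x = (hnorm x ^+ 2)%:C%C.
Proof. by rewrite dotp_norm -hnormE -rmorphXn. Qed.

Lemma dotp_swap0 H (x y : H) : dotp x y = 0 -> dotp y x = 0.
Proof. by move=> xy; rewrite dotpC xy rmorph0. Qed.

Lemma hnormB_sym H (x y : H) : hnorm (x - y) = hnorm (y - x).
Proof. by rewrite -hnormN opprB. Qed.

Lemma hnorm_pythagoras H (x y : H) : dotp x y = 0 ->
  hnorm (x + y) ^+ 2 = hnorm x ^+ 2 + hnorm y ^+ 2.
Proof.
move=> xy; apply: (@complexI R).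
by rewrite -dotp_hnorm dotDl !dotDr xy (dotp_swap0 xy) rmorphD /= -!dotp_hnorm addr0 add0r.
Qed.

Lemma rdot_le_hnorm H (x y : H) : rdot x y <= hnorm x * hnorm y.
Proof.
have [y0|y0] := eqVneq (hnorm y) 0.
  by rewrite (hnorm_eq0 y0) hnorm0 mulr0 /rdot dot0r.
have yp : 0 < hnorm y by rewrite lt_neqAle eq_sym y0 hnorm_ge0.
have [x0|x0] := eqVneq (hnorm x) 0.
  by rewrite (hnorm_eq0 x0) hnorm0 mul0r /rdot dot0l.
have xp : 0 < hnorm x by rewrite lt_neqAle eq_sym x0 hnorm_ge0.
have := exprn_ge0 2 (hnorm_ge0 ((hnorm y)%:C%C *: x - (hnorm x)%:C%C *: y)).
rewrite -rdot_norm !(rdotDl, rdotDr, rdotNl, rdotNr, rdotZl, rdotZr) !rdot_norm.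
rewrite (rdotC y x) => h.
have xy0 : 0 < 2 * (hnorm x * hnorm y) by rewrite !mulr_gt0.
by rewrite -(ler_pM2l xy0); lra.
Qed.

Lemma dotp_le_norm H (x y : H) : `|dotp x y| <= `|x| * `|y|.
Proof.
set c := dotp x y.
have [->|c0] := eqVneq c 0; first by rewrite normr0 mulr_ge0.
(* Replacing [y] by [c *: y] turns the inner product into [|c|^2], which is real, so the real
   inequality applies; one factor [|c|] then cancels. *)
have := rdot_le_hnorm x (c *: y).
rewrite -lecR rmorphM /= !hnormE normrZ /rdot dotZr -/c mulrC -normCK.
rewrite RRe_real ?rpredX ?normr_real // expr2 mulrCA ler_pM2l //.
by rewrite normr_gt0.
Qed.

Lemma hnorm_dotZ H K (x v : H) (w : K) :
  hnorm (dotp x v *: w) <= hnorm x * hnorm v * hnorm w.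
Proof.
rewrite -lecR !rmorphM /= !hnormE normrZ ler_wpM2r //.
exact: dotp_le_norm.
Qed.

Lemma hnormB_le H (x y z : H) : hnorm (x - z) <= hnorm (x - y) + hnorm (y - z).
Proof. by rewrite -{1}(subrK y x) -addrA hnormD. Qed.

Lemma hnorm_sum H I (r : seq I) (P : pred I) (f : I -> H) :
  hnorm (\sum_(i <- r | P i) f i) <= \sum_(i <- r | P i) hnorm (f i).
Proof.
elim/big_rec2: _ => [|i a b _ h]; first by rewrite hnorm0.
by rewrite (le_trans (hnormD _ _)) // lerD2l.
Qed.

Lemma invS_small (e : R) : 0 < e ->
  exists N, forall n, (N <= n)%N -> n.+1%:R^-1 <= e.
Proof.
move=> e0; exists (Num.truncn e^-1) => n Nn.
rewrite -[leRHS]invrK lef_pV2 ?posrE ?invr_gt0 //.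
by rewrite (le_trans (ltW (truncnS_gt _))) // ler_nat.
Qed.

(** Norms take values in [R[i]], so the radii in the topological statements are positive complex
    numbers; this brings them back to [R]. *)
Lemma gtr0_complexP (e : R[i]) : 0 < e -> exists2 r : R, 0 < r & e = r%:C%C.
Proof.
case: e => a b; rewrite ltcE /= => /andP[/eqP b0 a0].
by exists a => //; rewrite b0.
Qed.

Lemma hcauchy_limit H (u : nat -> H) :
  (forall e : R, 0 < e -> exists N, forall m n, (N <= m)%N -> (N <= n)%N ->
    hnorm (u m - u n) <= e) ->
  exists l, forall e : R, 0 < e -> exists N, forall n, (N <= n)%N ->
    hnorm (u n - l) <= e.
Proof.
move=> cu.
have /cauchy_cvgP/cvg_ex[l /cvgrPdist_lt ul] : cauchy (u @ \oo).
  apply/cauchy_ballP => _ /gtr0_complexP[e e0 ->].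
  have [N NP] := cu (e / 2) (divr_gt0 e0 (ltr0Sn _ _)).
  exists (u @` [set n | (N <= n)%N], u @` [set n | (N <= n)%N]).
    by split=> /=; exists N => // n /= Nn; exists n.
  move=> [_ _] /= [[m Nm <-] [n Nn <-]]; rewrite -ball_normE /=.
  rewrite -hnormE ltcR (le_lt_trans (NP _ _ Nm Nn)) //; lra.
exists l => e e0; have e0c : 0 < e%:C%C by rewrite ltcR.
have [N _ NP] := ul _ e0c; exists N => n /NP /=.
by rewrite -hnormE ltcR hnormB_sym => /ltW.
Qed.

Lemma closed_approx H (M : set H) x : closed M ->
  (forall e : R, 0 < e -> exists2 y, M y & hnorm (y - x) <= e) -> M x.
Proof.
move=> clM Mx; apply: clM => B /nbhs_ballP[_ /gtr0_complexP[e e0 ->] eB].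
have [y My yx] := Mx (e / 2) (divr_gt0 e0 (ltr0Sn _ _)).
exists y; split=> //; apply: eB; rewrite -ball_normE /= -hnormE ltcR hnormB_sym.
by rewrite (le_lt_trans yx) //; lra.
Qed.

Lemma closure_approx H (M : set H) x : closure M x ->
  forall e : R, 0 < e -> exists2 y, M y & hnorm (y - x) <= e.
Proof.
move=> cM e e0; have e0c : 0 < e%:C%C by rewrite ltcR.
have [y [My]] := cM _ (nbhsx_ballx x _ e0c).
by rewrite -ball_normE /= -hnormE ltcR hnormB_sym => /ltW ?; exists y.
Qed.

Lemma approx_closed H (M : set H) :
  (forall x, (forall e : R, 0 < e -> exists2 y, M y & hnorm (y - x) <= e) -> M x) ->
  closed M.
Proof. by move=> h x cx; apply: h; exact: closure_approx. Qed.

Definition subspace H (M : set H) : Prop :=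
  [/\ closed M, M 0 & forall c x y, M x -> M y -> M (c *: x + y)].

Definition orth H (M : set H) : set H := [set x | forall y, M y -> dotp x y = 0].

Lemma subspaceD H (M : set H) x y : subspace M -> M x -> M y -> M (x + y).
Proof. by move=> [_ _ lM] Mx My; rewrite -[x]scale1r; exact: lM. Qed.

Lemma subspaceZ H (M : set H) c x : subspace M -> M x -> M (c *: x).
Proof. by move=> [_ M0 lM] Mx; rewrite -[_ *: _]addr0; exact: lM. Qed.

Lemma subspaceB H (M : set H) x y : subspace M -> M x -> M y -> M (x - y).
Proof. by move=> sM Mx My; rewrite -scaleN1r; apply: subspaceD => //; exact: subspaceZ. Qed.

Lemma dotp_approx0 H (x y : H) :
  (forall e : R, 0 < e -> exists2 z, dotp z y = 0 & hnorm (z - x) <= e) ->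
  dotp x y = 0.
Proof.
move=> h; apply/eqP; rewrite -normr_eq0; apply/eqP.
have -> : `|dotp x y| = (complex.Re `|dotp x y|)%:C%C.
  by rewrite RRe_real // normr_real.
congr (_%:C%C); apply/eqP; rewrite eq_le; apply/andP; split; last first.
  by have := normr_ge0 (dotp x y); rewrite lecE => /andP[].
apply/ler_addgt0Pr => e e0; rewrite add0r.
have y1 : 0 < hnorm y + 1 by rewrite ltr_wpDl ?hnorm_ge0.
have [z zy zx] := h (e / (hnorm y + 1)) (divr_gt0 e0 y1).
rewrite -lecR RRe_real ?normr_real //.
rewrite -[dotp x y]subr0 -zy -dotBl (le_trans (dotp_le_norm _ _)) //.
rewrite -!hnormE -rmorphM lecR hnormB_sym.
apply: (@le_trans _ _ (e / (hnorm y + 1) * hnorm y)).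
  by rewrite ler_wpM2r ?hnorm_ge0.
by rewrite mulrAC ler_pdivrMr // ler_pM2l // lerDl.
Qed.

Lemma orth_subspace H (M : set H) : subspace (orth M).
Proof.
split=> [|y _|c x y Mx My z Mz].
- apply: approx_closed => x h y My; apply: dotp_approx0 => e e0.
  by have [z Mz zx] := h e e0; exists z => //; exact: Mz.
- by rewrite dot0l.
- by rewrite dotDl dotZl Mx // My // mulr0 addr0.
Qed.

Lemma parallelogram H (x y : H) :
  hnorm (x + y) ^+ 2 + hnorm (x - y) ^+ 2 = 2 * hnorm x ^+ 2 + 2 * hnorm y ^+ 2.
Proof.
by rewrite -!rdot_norm !(rdotDl, rdotDr, rdotNl, rdotNr) (rdotC y x); ring.
Qed.

Lemma min_dist_orth H (M : set H) (x p : H) : subspace M -> M p ->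
  (forall y, M y -> hnorm (x - p) ^+ 2 <= hnorm (x - y) ^+ 2) -> orth M (x - p).
Proof.
move=> sM Mp pmin y My.
set w := x - p.
have pm z : M z -> hnorm w ^+ 2 <= hnorm (w - z) ^+ 2.
  by move=> Mz; rewrite /w -addrA -opprD; apply: pmin; exact: subspaceD.
clearbody w; set c := dotp w y.
(* Minimality is tested against [p] moved by [t c y]: the factor [c] makes the linear term exactly
   [-2t|c|^2], so the quadratic is negative for small positive [t] unless [c = 0]. The value
   [u / (v + 1)] used below is such a [t]. *)
have h (t : R) : 0 <= - (2 * t) * complex.Re (`|c| ^+ 2) + t ^+ 2 * hnorm (c *: y) ^+ 2.
  have := pm _ (subspaceZ t%:C%C sM (subspaceZ c sM My)).
  rewrite -[in leRHS]rdot_norm !(rdotDl, rdotDr, rdotNl, rdotNr, rdotZl, rdotZr).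
  rewrite (rdotC _ w) !rdot_norm [rdot w _]/rdot dotZr -/c -normCKC.
  move=> h; lra.
have c2 : 0 <= complex.Re (`|c| ^+ 2).
  by have := exprn_ge0 2 (normr_ge0 c); rewrite lecE => /andP[].
have c0 : complex.Re (`|c| ^+ 2) = 0.
  apply/eqP; rewrite eq_le c2 andbT leNgt; apply/negP => cp.
  set u := complex.Re _ in h c2 cp; set v := hnorm _ ^+ 2 in h.
  have v0 : 0 <= v by rewrite exprn_ge0 // hnorm_ge0.
  have v1 : 0 < v + 1 by lra.
  have := h (u / (v + 1)).
  have -> : - (2 * (u / (v + 1))) * u + (u / (v + 1)) ^+ 2 * v =
    - (u / (v + 1)) ^+ 2 * (v + 2) by field; rewrite gt_eqF.
  rewrite mulNr oppr_ge0 leNgt mulr_gt0 //; last lra.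
  by rewrite exprn_gt0 // divr_gt0.
have : `|c| ^+ 2 = 0 by rewrite -[LHS]RRe_real ?c0 // rpredX ?normr_real.
by move/eqP; rewrite sqrf_eq0 normr_eq0 => /eqP.
Qed.

(** A minimizing sequence for the distance is Cauchy by the parallelogram law, because the midpoints
    of its terms stay in [M]. *)
Lemma projection H (M : set H) x : subspace M -> exists2 p, M p & orth M (x - p).
Proof.
move=> sM; have [clM M0 _] := sM.
pose D := [set hnorm (x - y) ^+ 2 | y in M].
have D0 : has_inf D.
  split; first by exists (hnorm (x - 0) ^+ 2), 0.
  by exists 0 => _ [y _ <-]; rewrite exprn_ge0 // hnorm_ge0.
pose d := inf D.
have dD y : M y -> d <= hnorm (x - y) ^+ 2.
  by move=> My; apply: ge_inf; [case: D0|exists y].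
have /choice[u uP] : forall n : nat, exists y, M y /\ hnorm (x - y) ^+ 2 < d + n.+1%:R^-1.
  move=> n; have [|_ [y My <-] yd] := @inf_adherent _ D n.+1%:R^-1 _ D0.
    by rewrite invr_gt0.
  by exists y.
have um m n : hnorm (u m - u n) ^+ 2 <= 2 * m.+1%:R^-1 + 2 * n.+1%:R^-1.
  have [[Mm dm] [Mn dn]] := (uP m, uP n).
  have half : (2^-1)%:C%C + (2^-1)%:C%C = 1 :> R[i].
    by rewrite -rmorphD /= -[RHS]/((1 : R)%:C%C); congr (_%:C%C); lra.
  have := dD ((2^-1)%:C%C *: (u m + u n)) (subspaceZ _ sM (subspaceD sM Mm Mn)).
  have -> : x - (2^-1)%:C%C *: (u m + u n) =
      (2^-1)%:C%C *: ((x - u m) + (x - u n)).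
    by rewrite addrACA -opprD scalerBr (scalerDr _ x x) -scalerDl half scale1r.
  rewrite hnormZ ger0_norm ?invr_ge0 // exprMn.
  have := parallelogram (x - u m) (x - u n).
  have -> : hnorm (x - u m - (x - u n)) = hnorm (u m - u n).
    by rewrite -hnormN; congr hnorm; rewrite !opprB addrC addrA subrK.
  move: dm dn; set a1 := m.+1%:R^-1; set a2 := n.+1%:R^-1.
  set h1 := hnorm _; set h2 := hnorm _; set h3 := hnorm _; set h4 := hnorm _.
  clearbody a1 a2 h1 h2 h3 h4.
  by lra.
have [p pP] : exists l, forall e : R, 0 < e -> exists N, forall n, (N <= n)%N ->
    hnorm (u n - l) <= e.
  apply: hcauchy_limit => e e0.
  have e2 : 0 < e ^+ 2 / 4 by rewrite divr_gt0 // exprn_gt0.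
  have [N inv_le] := invS_small e2.
  exists N => m n /inv_le im /inv_le jn.
  rewrite -ler_sqr ?nnegrE ?hnorm_ge0 ?(ltW e0) // (le_trans (um m n)) //.
  by move: im jn; set a1 := m.+1%:R^-1; set a2 := n.+1%:R^-1; clearbody a1 a2; lra.
have Mp : M p.
  apply: closed_approx => // e e0; have [N NP] := pP e e0.
  by exists (u N); [case: (uP N)|exact: NP].
exists p => //; apply: min_dist_orth => // y My.
apply: le_trans (dD _ My).
suff h (e : R) : 0 < e -> hnorm (x - p) <= Num.sqrt (d + e) + e.
  have d0 : 0 <= d by apply: lb_le_inf; [case: D0|move=> _ [z _ <-]; rewrite exprn_ge0 // hnorm_ge0].
  rewrite leNgt; apply/negP => dlt.
  have sd : Num.sqrt d < hnorm (x - p).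
    by rewrite -ltr_sqr ?nnegrE ?sqrtr_ge0 ?hnorm_ge0 // sqr_sqrtr.
  set z := hnorm (x - p) in h sd dlt.
  have s0 := sqrtr_ge0 d; set sq := Num.sqrt d in sd s0.
  have sq2 : sq ^+ 2 = d by rewrite sqr_sqrtr.
  (* With [e = min(t, t^2)] one has [sqrt(d + e) <= sq + t], so the bound [h] gives at most
     [sq + 2t], which falls short of [z] by half the gap. *)
  pose t := (z - sq) / 4.
  have t0 : 0 < t by rewrite divr_gt0 // subr_gt0.
  have e0 : 0 < Num.min t (t ^+ 2) by rewrite lt_min t0 exprn_gt0.
  have := h _ e0; apply/negP; rewrite -ltNge.
  apply: (@le_lt_trans _ _ ((sq + t) + t)).
    rewrite lerD ?ge_min ?lexx // -[leRHS]ger0_norm; last by lra.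
    rewrite -sqrtr_sqr ler_wsqrtr // sqrrD sq2.
    have : Num.min t (t ^+ 2) <= t ^+ 2 by rewrite ge_min lexx orbT.
    by have := mulr_ge0 s0 (ltW t0); lra.
  by rewrite /t; lra.
move=> e0; have [N NP] := pP e e0.
have [N' N'P] := invS_small e0.
pose n := maxn N N'.
have [_ un] := uP n.
apply: (le_trans (hnormB_le _ (u n) _)); apply: lerD; last by apply: NP; rewrite leq_maxl.
rewrite -[leLHS]ger0_norm ?hnorm_ge0 // -sqrtr_sqr ler_wsqrtr //.
by apply: (le_trans (ltW un)); rewrite lerD2l N'P // leq_maxr.
Qed.

Lemma orth_orth H (M : set H) : subspace M -> orth (orth M) = M.
Proof.
move=> sM; apply/seteqP; split=> [x xM|x Mx y yM]; last exact/dotp_swap0/yM.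
have [p Mp xp] := projection x sM.
suff -> : x = p by [].
apply/eqP; rewrite -subr_eq0; apply/eqP/dotp_eq0P => z.
suff h : dotp (x - p) (x - p) = 0.
  move: h => /eqP; rewrite dotp_norm sqrf_eq0 normr_eq0 => /eqP ->.
  by rewrite dot0l.
by rewrite dotBr (dotp_swap0 (xM _ xp)) (xp _ Mp) subrr.
Qed.

End HilbertSpaces.

(** * Spectral theory of compact positive operators *)

Section CompactPositive.
Context (R : realType).
Implicit Types H K : hilbertType R.

Definition orthonormal_family H n (e : 'I_n -> H) : Prop :=
  forall i j, dotp (e i) (e j) = (i == j)%:R.

Lemma orthonormal_hnorm H n (e : 'I_n -> H) i : orthonormal_family e -> hnorm (e i) = 1.
Proof.
move=> on; apply/eqP; rewrite -(@eqrXn2 _ 2) ?hnorm_ge0 // expr1n; apply/eqP.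
by apply: (@complexI R); rewrite -dotp_hnorm on eqxx.
Qed.

Lemma real_scaler_continuous H (w : H) : continuous (fun t : R => t%:C%C *: w).
Proof.
move=> s; apply/cvgrPdist_lt => _ /gtr0_complexP[e e0 ->].
have w1 : 0 < hnorm w + 1 by rewrite ltr_wpDl ?hnorm_ge0.
near=> t.
rewrite -hnormE ltcR -scalerBl -rmorphB hnormZ.
have st : `|s - t| < e / (hnorm w + 1).
  near: t; move: (e / (hnorm w + 1)) (divr_gt0 e0 w1) => r r0.
  by apply: (@cvgr_dist_lt _ _ _ (nbhs s) _ id).
rewrite (@le_lt_trans _ _ (`|s - t| * (hnorm w + 1))) //.
  by rewrite ler_wpM2l // lerDl.
by rewrite -ltr_pdivlMr.
Unshelve. all: by end_near. Qed.

(** The image of the unit ball lies in the image of a compact square under a continuous map: the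
    square holds the real and imaginary parts of the coefficient. *)
Lemma rank_one_compact H K (v : H) (w : K) :
  compact_op (fun x => dotp x v *: w).
Proof.
split; first by move=> c x y; rewrite dotDl dotZl scalerDl scalerA.
pose I := `[- hnorm v, hnorm v]%classic : set R.
pose f (p : R * R) : K := p.1%:C%C *: w + p.2%:C%C *: ('i%C *: w).
have cf : continuous f.
  move=> p; apply: (@cvgD _ _ _ _ (nbhs_filter p)).
    by apply: (@continuous_comp _ _ _ fst (fun t : R => t%:C%C *: w));
      [exact: cvg_fst|exact: real_scaler_continuous].
  by apply: (@continuous_comp _ _ _ snd (fun t : R => t%:C%C *: ('i%C *: w)));
    [exact: cvg_snd|exact: real_scaler_continuous].
apply: (@precompact_subset _ _ (f @` (I `*` I))); last first.
  apply: compact_precompact; first exact: norm_hausdorff.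
  apply: continuous_compact; first exact: continuous_subspaceT.
  by apply: compact_setX; exact: segment_compact.
move=> _ [x x1 <-].
have xv : `|dotp x v| <= (hnorm v)%:C%C.
  rewrite (le_trans (dotp_le_norm x v)) // hnormE -[leRHS]mul1r.
  exact: ler_wpM2r.
exists (complex.Re (dotp x v), complex.Im (dotp x v)).
  split; rewrite /I /= in_itv /= -ler_norml -lecR (le_trans _ xv) //.
    exact: normc_ge_Re.
  rewrite -normrN -ReiNIm (le_trans (normc_ge_Re _)) // normrM.
  by rewrite complexiE normCi mulr1.
by rewrite /f /= scalerA -scalerDl [in RHS](complexE (dotp x v)) (mulrC 'i%C).
Qed.

Lemma compact_op0 H K : compact_op (fun _ : H => 0 : K).
Proof.
have := rank_one_compact (0 : H) (0 : K).
by congr (compact_op _); apply/funext => x; rewrite scaler0.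
Qed.

(** For [v = w] an orthonormal family this is the orthogonal projection onto its span. *)
Definition finite_rank H K n (v : 'I_n -> H) (w : 'I_n -> K) (x : H) : K :=
  \sum_i dotp x (v i) *: w i.

Lemma finite_rank_compact H K n (v : 'I_n -> H) (w : 'I_n -> K) :
  compact_op (finite_rank v w).
Proof.
elim: n v w => [|n IH] v w.
  have := compact_op0 H K; congr (compact_op _); apply/funext => x.
  by rewrite /finite_rank big_ord0.
have := compact_op_add (rank_one_compact (v ord0) (w ord0))
  (IH (v \o lift ord0) (w \o lift ord0)).
by congr (compact_op _); apply/funext => x; rewrite /finite_rank big_ord_recl.
Qed.

Lemma finite_rank_adjoint H K n (v : 'I_n -> H) (w : 'I_n -> K) :
  adjoint (finite_rank v w) (finite_rank w v).
Proof.
move=> x y; rewrite dot_suml dot_sumr; apply: eq_bigr => i _.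
by rewrite dotZl dotZr -(dotpC (w i) y) mulrC.
Qed.

(** The norm attains its maximum [l] on the compact closure of the image under [a] of the unit ball
    of [M]. The maximizer [y0] is a limit of values of [a], not necessarily a value, and turns out
    to be an eigenvector itself. *)
Lemma max_eigenvector H (a : H -> H) (M : set H) :
  compact_op a -> positive_op a -> subspace M -> (forall x, M x -> M (a x)) ->
  (exists2 x, M x & a x <> 0) ->
  exists (y : H) (l : R), [/\ M y, hnorm y = 1, 0 < l, a y = l%:C%C *: y &
    forall x, M x -> hnorm (a x) <= l * hnorm x].
Proof.
move=> ca pa sM aM [x0 Mx0 ax0]; have [la pra] := ca.
have [clM M0 _] := sM.
have [N [N0 bN]] := compact_op_bounded ca.
have aa := positive_op_adjoint la pa.
have cont_a : continuous a by apply: bounded_linear_op_continuous => //; exists N.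
pose B := a @` [set x | M x /\ `|x| <= 1].
have cB : compact (closure B).
  rewrite -precompactE; apply: precompact_subset pra.
  by move=> _ [x [_ x1] <-]; exists x.
have B0 : closure B !=set0.
  by exists (a 0); apply: subset_closure; exists 0 => //; split=> //=; rewrite normr0.
have [|y0 /set_mem By0 y0max] := @compact_EVT_max _ _ (@hnorm R H) _ B0 cB.
  by apply: continuous_subspaceT; exact: hnorm_continuous.
set l := hnorm y0 in y0max.
have le_l x : M x -> hnorm (a x) <= l * hnorm x.
  move=> Mx; have [x_0|xn0] := eqVneq (hnorm x) 0.
    by rewrite (hnorm_eq0 x_0) linear_op0 // !hnorm0 mulr0.
  have xp : 0 < hnorm x by rewrite lt_neqAle eq_sym xn0 hnorm_ge0.
  have := y0max (a ((hnorm x)^-1%:C%C *: x)).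
  rewrite linear_opZ // hnormZ ger0_norm ?invr_ge0 ?hnorm_ge0 //.
  rewrite mulrC ler_pdivrMr //; apply; apply/mem_set/subset_closure.
  exists ((hnorm x)^-1%:C%C *: x); last by rewrite linear_opZ.
  split; first exact: subspaceZ.
  rewrite -hnormE hnormZ ger0_norm ?invr_ge0 ?hnorm_ge0 // mulVf //.
have l0 : 0 < l.
  rewrite lt_neqAle hnorm_ge0 andbT eq_sym; apply/eqP => l_0; apply: ax0.
  apply: hnorm_eq0; apply/eqP; rewrite eq_le hnorm_ge0 andbT.
  by have := le_l _ Mx0; rewrite l_0 mul0r.
have My0 : M y0.
  apply: clM; apply: (closure_subset _ By0) => _ [x [Mx _] <-]; exact: aM.
(* [F] is built to pass to the closure: it is continuous and bounded by [(N l)^2 l^2] on [B], hence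
   at [y0]. There the second summand already equals the bound, as [hnorm y0 = l], so the first
   vanishes and [a (a y0) = l^2 y0]. *)
pose F y := hnorm (a (a y) - (l ^+ 2)%:C%C *: y) ^+ 2 + (N * l) ^+ 2 * hnorm y ^+ 2.
have Fle y : B y -> F y <= (N * l) ^+ 2 * l ^+ 2.
  move=> [x [Mx x1] <-]; rewrite /F.
  have x1' : hnorm x <= 1 by rewrite -lecR hnormE.
  rewrite -linear_opZ // -linear_opN // -linear_opD //.
  apply: (@le_trans _ _ ((N * hnorm (a (a x) - (l ^+ 2)%:C%C *: x)) ^+ 2 +
      (N * l) ^+ 2 * hnorm (a x) ^+ 2)).
    by rewrite lerD2r ler_sqr ?nnegrE ?mulr_ge0 ?hnorm_ge0 // ltW.
  have key : hnorm (a (a x) - (l ^+ 2)%:C%C *: x) ^+ 2 + l ^+ 2 * hnorm (a x) ^+ 2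
      <= l ^+ 2 * l ^+ 2.
    have h1 : hnorm (a (a x)) ^+ 2 <= l ^+ 2 * hnorm (a x) ^+ 2.
      rewrite -exprMn ler_sqr ?nnegrE ?mulr_ge0 ?hnorm_ge0 //.
      by apply: le_l; exact: aM.
    have h2 : hnorm x ^+ 2 <= 1 by rewrite -[leRHS](expr1n _ 2) ler_sqr ?nnegrE ?hnorm_ge0.
    have h3 : (l ^+ 2) ^+ 2 * hnorm x ^+ 2 <= (l ^+ 2) ^+ 2 * 1.
      by rewrite ler_wpM2l // sqr_ge0.
    rewrite -rdot_norm !(rdotDl, rdotDr, rdotNl, rdotNr, rdotZl, rdotZr).
    rewrite (rdotC x (a (a x))) (adjoint_rdot _ x aa) !rdot_norm.
    lra.
  have := ler_wpM2l (ltW (exprn_gt0 2 N0)) key; rewrite !exprMn; lra.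
have F0 : F y0 <= (N * l) ^+ 2 * l ^+ 2.
  have cF : continuous F.
    have cN (g : H -> H) : continuous g -> continuous (fun y => hnorm (g y) ^+ 2).
      move=> cg y; apply: (@continuous_comp _ _ _ (fun y => hnorm (g y)) (fun t => t ^+ 2)).
        by apply: (@continuous_comp _ _ _ g (@hnorm R H)); [exact: cg|exact: hnorm_continuous].
      exact: exprn_continuous.
    move=> y; apply: cvgD.
      apply: (cN (fun y => a (a y) - (l ^+ 2)%:C%C *: y)) => z; apply: cvgB.
        by apply: (@continuous_comp _ _ _ a a); exact: cont_a.
      exact: scaler_continuous.
    by apply: cvgM; [exact: cvg_cst|apply: (cN id) => z; exact: cvg_id].
  have : closed (F @^-1` [set t | t <= (N * l) ^+ 2 * l ^+ 2]).
    apply: preimage_closed; first by move=> x _; exact: cF.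
    exact: closed_le.
  by apply; apply: (closure_subset _ By0) => y /Fle.
have aay : a (a y0) = (l ^+ 2)%:C%C *: y0.
  apply/eqP; rewrite -subr_eq0; apply/eqP/hnorm_eq0/eqP.
  rewrite -sqrf_eq0 eq_le exprn_ge0 ?hnorm_ge0 // andbT.
  by move: F0; rewrite /F -/l gerDr.
have ay : a y0 = l%:C%C *: y0.
  apply/eqP; rewrite -subr_eq0; apply/eqP.
  (* Now [a z = - l z], which positivity of [a] allows only for [z = 0]. *)
  set z := _ - _.
  have az : a z = - (l%:C%C *: z).
    rewrite /z linear_opD // linear_opN // linear_opZ // aay scalerBr scalerA.
    by rewrite -rmorphM -expr2 opprB.
  have := pa z; rewrite az dotNl dotZl dotp_hnorm -rmorphM -rmorphN /= lecE /=.
  move=> /andP[_]; rewrite oppr_ge0 pmulr_rle0 // => z0.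
  by apply: hnorm_eq0; apply/eqP; rewrite -sqrf_eq0 eq_le z0 exprn_ge0 ?hnorm_ge0.
exists (l^-1%:C%C *: y0), l; split=> //.
- exact: subspaceZ.
- by rewrite hnormZ ger0_norm ?invr_ge0 ?(ltW l0) // mulVf ?gt_eqF.
- by rewrite linear_opZ // ay !scalerA mulrC.
Qed.

Lemma eigenvectors_orth H (a : H -> H) (l m : R) x y : adjoint a a ->
  a x = l%:C%C *: x -> a y = m%:C%C *: y -> l != m -> dotp x y = 0.
Proof.
move=> aa ax ay lm; have := aa x y; rewrite ax ay dotZl dotZr => /eqP.
have -> : Num.conj m%:C%C = m%:C%C :> R[i] by exact: conjc_real.
rewrite -subr_eq0 -mulrBl mulf_eq0 subr_eq0 => /orP[/eqP/complexI lm'|/eqP//].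
by rewrite lm' eqxx in lm.
Qed.

(** By Pythagoras the vectors [a (e i)] are at mutual distance at least [eps], so each ball of
    radius [eps / 2] in a finite cover of the closed image of the unit ball holds at most one of
    them. *)
Lemma eigenfamily_card H (a : H -> H) (eps : R) : compact_op a -> 0 < eps ->
  exists N : nat, forall n (e : 'I_n -> H) (l : 'I_n -> R),
    orthonormal_family e -> (forall i, a (e i) = (l i)%:C%C *: e i) ->
    (forall i, eps <= l i) -> (n <= N)%N.
Proof.
move=> [la]; rewrite precompactE compact_cover => ca e0.
have e2 : 0 < (eps / 2)%:C%C by rewrite ltcR divr_gt0.
pose U (y : H) := (ball y (eps / 2)%:C%C)°.
have [|y _|D _ DP] := ca H setT U.
- by move=> y _; exact: open_interior.
- by exists y => //; exact: nbhsx_ballx.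
exists #|` D|%fset => n e l on ae le.
have /choice[k kP] : forall i, exists k : D, ball (val k) (eps / 2)%:C%C (a (e i)).
  move=> i; have [|y Dy /interior_subset yi] := DP (a (e i)).
    apply: subset_closure; exists (e i) => //=.
    by rewrite -hnormE orthonormal_hnorm.
  by exists [` Dy]%fset.
rewrite -[n in (n <= _)%N]card_ord cardfE; apply: (@leq_card _ _ k) => i j kij.
apply/eqP/negPn/negP => ij.
have := kP i; have := kP j; rewrite kij -!ball_normE /= -!hnormE !ltcR => hj hi.
have hij : hnorm (a (e i) - a (e j)) < eps.
  rewrite (le_lt_trans (hnormB_le _ (val (k j)) _)) // [ltRHS]splitr.
  by rewrite ltrD // hnormB_sym.
have : eps ^+ 2 <= hnorm (a (e i) - a (e j)) ^+ 2.
  have -> : hnorm (a (e i) - a (e j)) ^+ 2 = l i ^+ 2 + l j ^+ 2.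
    rewrite hnorm_pythagoras; last first.
      by rewrite !ae dotNr dotZl dotZr on (negbTE ij) !mulr0 oppr0.
    by rewrite hnormN !ae !hnormZ !orthonormal_hnorm // !mulr1 !real_normK ?num_real.
  have := sqr_ge0 (l j); suff : eps ^+ 2 <= l i ^+ 2 by lra.
  by rewrite ler_sqr ?nnegrE // ?(ltW e0) // (le_trans (ltW e0)).
by rewrite ler_sqr ?nnegrE ?hnorm_ge0 ?(ltW e0) // leNgt hij.
Qed.

End CompactPositive.

(** * Cut-off functional calculus of a compact positive operator *)

Section FunctionalCalculus.
Context (R : realType).
Implicit Types H K : hilbertType R.

Lemma linear_op_sum H K (T : H -> K) n (c : 'I_n -> R[i]) (v : 'I_n -> H) :
  linear T -> T (\sum_i c i *: v i) = \sum_i c i *: T (v i).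
Proof.
move=> lT; elim/big_rec2: _ => [|i x y _ <-]; first exact: linear_op0.
exact: lT.
Qed.

Lemma hnormZC H (c : R[i]) (x : H) : hnorm (c *: x) = complex.Re `|c| * hnorm x.
Proof.
apply: (@complexI R); rewrite hnormE normrZ rmorphM; congr (_ * _).
by rewrite /= RRe_real ?normr_real.
Qed.

Lemma Re_norm_ge0 (c : R[i]) : 0 <= complex.Re `|c|.
Proof. by have := normr_ge0 c; rewrite lecE => /andP[]. Qed.

Lemma closure_subspace H (V : set H) :
  V 0 -> (forall c x y, V x -> V y -> V (c *: x + y)) -> subspace (closure V).
Proof.
move=> V0 lV; split; [exact: closed_closure|exact: subset_closure|].
move=> c x y cx cy; apply: closed_approx; first exact: closed_closure.
move=> e e0; have c0 := Re_norm_ge0 c.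
have c1 : 0 < complex.Re `|c| + 1 by rewrite ltr_wpDl.
have [u Vu ux] := closure_approx cx (divr_gt0 (divr_gt0 e0 (ltr0Sn _ 1)) c1).
have [v Vv vy] := closure_approx cy (divr_gt0 e0 (ltr0Sn _ 1)).
exists (c *: u + v); first by apply: subset_closure; exact: lV.
rewrite opprD addrACA -scalerBr (le_trans (hnormD _ _)) // [leRHS]splitr lerD //.
rewrite hnormZC (le_trans (ler_wpM2l c0 ux)) // mulrA ler_pdivrMr //.
by rewrite mulrC ler_pM2l ?divr_gt0 // lerDl.
Qed.

Section OrthonormalProjection.
Context (H : hilbertType R) (n : nat) (e : 'I_n -> H)
  (e_on : orthonormal_family e).
Local Notation P := (finite_rank e e).

Lemma onproj_dot x i : dotp (P x) (e i) = dotp x (e i).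
Proof.
rewrite dot_suml (bigD1 i) //= big1 ?addr0 => [|j ji].
  by rewrite dotZl e_on eqxx mulr1.
by rewrite dotZl e_on (negbTE ji) mulr0.
Qed.

Lemma onproj_eq0 x : (forall i, dotp x (e i) = 0) -> P x = 0.
Proof. by move=> x0; apply: big1 => i _; rewrite x0 scale0r. Qed.

Lemma onproj_id x : P (P x) = P x.
Proof. by apply: eq_bigr => i _; rewrite onproj_dot. Qed.

Lemma onproj_adjoint : adjoint P P.
Proof. exact: finite_rank_adjoint. Qed.

Lemma onproj_pythagoras x : hnorm (P x) ^+ 2 + hnorm (x - P x) ^+ 2 = hnorm x ^+ 2.
Proof.
have h : dotp (P x) (x - P x) = 0.
  by rewrite dotBr !(onproj_adjoint x) onproj_id subrr.
by rewrite -(hnorm_pythagoras h) [P x + _]addrC subrK.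
Qed.

Lemma onproj_le x : hnorm (P x) <= hnorm x.
Proof.
rewrite -ler_sqr ?nnegrE ?hnorm_ge0 // -(onproj_pythagoras x).
by rewrite lerDl sqr_ge0.
Qed.

Lemma onproj_compl_le x : hnorm (x - P x) <= hnorm x.
Proof.
rewrite -ler_sqr ?nnegrE ?hnorm_ge0 // -(onproj_pythagoras x).
by rewrite lerDr sqr_ge0.
Qed.

End OrthonormalProjection.

(* The last condition says that the e i span all eigenspaces of a with
   eigenvalue at least eps. *)
Definition spectral_family H (a : H -> H) (eps : R) n (e : 'I_n -> H)
    (l : 'I_n -> R) : Prop :=
  [/\ orthonormal_family e, forall i, a (e i) = (l i)%:C%C *: e i,
      forall i, eps <= l i &
      forall x (m : R), eps <= m -> a x = m%:C%C *: x -> finite_rank e e x = x].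

(** A family of maximal length works: if an eigenvector with eigenvalue at least [eps] left the
    span, its component orthogonal to the span would again be an eigenvector and would lengthen the
    family. *)
Lemma spectral_family_exists H (a : H -> H) (eps : R) :
  compact_op a -> positive_op a -> 0 < eps ->
  exists n (e : 'I_n -> H) (l : 'I_n -> R), spectral_family a eps e l.
Proof.
move=> ca pa e0; have [la _] := ca.
have aa := positive_op_adjoint la pa.
pose Q n := `[< exists (e : 'I_n -> H) (l : 'I_n -> R), [/\ orthonormal_family e,
  forall i, a (e i) = (l i)%:C%C *: e i & forall i, eps <= l i] >].
have exQ : exists n, Q n.
  by exists 0%N; apply/asboolP; exists (fun=> 0), (fun=> 0); split=> -[].
have [N NP] := eigenfamily_card ca e0.
have bQ n : Q n -> (n <= N)%N.
  by move=> /asboolP[e [l [on ae le]]]; exact: NP on ae le.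
case: (ex_maxnP exQ bQ) => n /asboolP[e [l [on ae le]]] nmax.
exists n, e, l; split=> // x m em ax.
pose z := x - finite_rank e e x.
have ze i : dotp z (e i) = 0 by rewrite dotBl onproj_dot // subrr.
have az : a z = m%:C%C *: z.
  rewrite linear_opD // linear_opN // ax scalerBr; congr (_ - _).
  rewrite linear_op_sum // scaler_sumr; apply: eq_bigr => i _; rewrite ae.
  have [<-|lm] := eqVneq (l i) m; first by rewrite !scalerA mulrC.
  by rewrite (eigenvectors_orth aa ax (ae i)) 1?eq_sym // !scale0r scaler0.
have [z0|z0] := eqVneq z 0.
  by apply/esym/eqP; rewrite -subr_eq0 -/z z0.
suff /nmax : Q n.+1 by rewrite ltnn.
have hz : hnorm z != 0 by apply: contraNneq z0 => /hnorm_eq0 ->.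
pose w := (hnorm z)^-1%:C%C *: z.
have we i : dotp w (e i) = 0 by rewrite dotZl ze mulr0.
have ww : dotp w w = 1.
  rewrite dotp_hnorm hnormZ ger0_norm ?invr_ge0 ?hnorm_ge0 // mulVf //.
  by rewrite expr1n.
apply/asboolP; exists (fun i => oapp e w (unlift ord0 i)),
  (fun i => oapp l m (unlift ord0 i)); split.
- move=> i j; case: unliftP => [i'|] ->; case: unliftP => [j'|] -> //=.
  by rewrite dotp_swap0.
- by move=> i; case: unliftP => [i'|] _ //=; rewrite linear_opZ // az !scalerA mulrC.
- by move=> i; case: unliftP => [i'|] _ //=.
Qed.

(** For a spectral family of [a] at level [eps] this is [f(a)] on the span of the [e i] and 0 on its
    orthogonal complement. Only the values of [f] on [[eps, oo)] count, so inverses and inverse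
    roots are harmless. *)
Definition fcalc H n (e : 'I_n -> H) (l : 'I_n -> R) (f : R -> R) : H -> H :=
  finite_rank e (fun i => (f (l i))%:C%C *: e i).

Section SpectralFamily.
Context (H : hilbertType R) (a : H -> H) (eps : R) (n : nat) (e : 'I_n -> H)
  (l : 'I_n -> R) (ca : compact_op a) (pa : positive_op a) (eps0 : 0 < eps)
  (sf : spectral_family a eps e l).
Local Notation P := (finite_rank e e).
Local Notation F := (fcalc e l).

Let la : linear a := proj1 ca.
Let aa : adjoint a a := positive_op_adjoint la pa.
Let on : orthonormal_family e. Proof. by case: sf. Qed.
Let ae i : a (e i) = (l i)%:C%C *: e i. Proof. by case: sf. Qed.
Let le_l i : eps <= l i. Proof. by case: sf. Qed.

Lemma fcalc_linear f : linear (F f).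
Proof. by have [] := finite_rank_compact e (fun i => (f (l i))%:C%C *: e i). Qed.

Lemma fcalc_dot f x i : dotp (F f x) (e i) = (f (l i))%:C%C * dotp x (e i).
Proof.
rewrite dot_suml (bigD1 i) //= big1 ?addr0 => [|j ji].
  by rewrite !dotZl on eqxx mulr1 mulrC.
by rewrite !dotZl on (negbTE ji) !mulr0.
Qed.

Lemma fcalc_adjoint f : adjoint (F f) (F f).
Proof.
move=> x y; rewrite dot_suml dot_sumr; apply: eq_bigr => i _.
rewrite !dotZl !dotZr -(dotpC (e i) y).
have -> : Num.conj (f (l i))%:C%C = (f (l i))%:C%C :> R[i] by exact: conjc_real.
ring.
Qed.

Lemma fcalc_comp f g x : F f (F g x) = F (fun t => f t * g t) x.
Proof.
apply: eq_bigr => i _; rewrite fcalc_dot !scalerA rmorphM /=.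
by congr (_ *: _); ring.
Qed.

Lemma op_fcalc f x : a (F f x) = F (fun t => t * f t) x.
Proof.
rewrite linear_op_sum //; apply: eq_bigr => i _.
by rewrite linear_opZ // ae !scalerA rmorphM /=; congr (_ *: _); ring.
Qed.

Lemma fcalc_op f x : F f (a x) = F (fun t => t * f t) x.
Proof.
apply: eq_bigr => i _; rewrite aa ae dotZr !scalerA rmorphM /=.
have -> : Num.conj (l i)%:C%C = (l i)%:C%C :> R[i] by exact: conjc_real.
by congr (_ *: _); ring.
Qed.

Lemma fcalc_ext f g x : (forall t, eps <= t -> f t = g t) -> F f x = F g x.
Proof. by move=> fg; apply: eq_bigr => i _; rewrite fg. Qed.

Lemma fcalc1 x : F (fun=> 1) x = P x.
Proof. by apply: eq_bigr => i _; rewrite scale1r. Qed.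

Lemma fcalc_orth f x : (forall i, dotp x (e i) = 0) -> F f x = 0.
Proof. by move=> x0; apply: big1 => i _; rewrite x0 scale0r. Qed.

Lemma fcalc_eigen f x m : eps <= m -> a x = m%:C%C *: x -> F f x = (f m)%:C%C *: x.
Proof.
move=> em ax; have [_ _ _ /(_ x m em ax) Px] := sf.
rewrite -[in RHS]Px scaler_sumr; apply: eq_bigr => i _.
have [<-|lm] := eqVneq (l i) m; first by rewrite !scalerA mulrC.
by rewrite (eigenvectors_orth aa ax (ae i)) 1?eq_sym // !scale0r scaler0.
Qed.

(** Since [g] preserves the eigenspaces, it maps each [e i] to a vector on which the calculus acts
    by the same scalar [f (l i)]; since [h] preserves them, [g] preserves their orthogonal
    complement, where the calculus is 0. With [g] a group element this yields equivariance. *)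
Lemma fcalc_commute (g h : H -> H) f x : linear g -> adjoint g h ->
  (forall y, a (g y) = g (a y)) -> (forall y, a (h y) = h (a y)) ->
  F f (g x) = g (F f x).
Proof.
move=> lg gh ag ah; have lF := fcalc_linear f.
have lh := adjoint_linear gh.
rewrite -[in LHS](subrK (P x) x) linear_opD // linear_opD //.
rewrite [X in X + _]fcalc_orth ?add0r; last first.
  move=> i; rewrite gh.
  have <- : P (h (e i)) = h (e i).
    have [_ _ _ /(_ _ (l i) (le_l i))] := sf; apply.
    by rewrite ah ae linear_opZ.
  have lP : linear P by have [] := finite_rank_compact e e.
  rewrite -(onproj_adjoint e) (linear_opD _ _ lP) (linear_opN _ lP).
  by rewrite onproj_id // subrr dot0l.
rewrite linear_op_sum // linear_op_sum // linear_op_sum //.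
apply: eq_bigr => i _; congr (_ *: _).
rewrite (@fcalc_eigen _ _ (l i)) //; last by rewrite ag ae linear_opZ.
by rewrite linear_opZ.
Qed.

(** On the orthogonal complement of the [e i] the norm of [a] is an eigenvalue or 0. An eigenvalue
    above [eps] is impossible there, as its eigenvectors lie in the span. *)
Lemma spectral_tail x : hnorm (a (x - P x)) <= eps * hnorm x.
Proof.
pose M := orth [set e i | i in [set: 'I_n]].
have Me z : M z <-> forall i, dotp z (e i) = 0.
  by split=> [Mz i|Mz _ [i _ <-]]; [apply: Mz; exists i|exact: Mz].
set z := x - P x.
have Mz : M z by apply/Me => i; rewrite dotBl onproj_dot // subrr.
suff az : hnorm (a z) <= eps * hnorm z.
  by rewrite (le_trans az) // ler_pM2l // onproj_compl_le.
have [az0|az0] := eqVneq (a z) 0.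
  by rewrite az0 hnorm0 mulr_ge0 ?hnorm_ge0 // ltW.
have [|||y [m [My y1 m0 ay mP]]] := @max_eigenvector _ _ a M ca pa.
- exact: orth_subspace.
- by move=> y /Me My; apply/Me => i; rewrite aa ae dotZr My mulr0.
- by exists z => //; apply/eqP.
rewrite (le_trans (mP _ Mz)) // ler_wpM2r ?hnorm_ge0 //.
rewrite leNgt; apply/negP => em.
have [_ _ _ /(_ y m (ltW em) ay)] := sf.
rewrite (onproj_eq0 ((Me y).1 My)) => y0.
by move/eqP: y1; rewrite -y0 hnorm0 eq_sym oner_eq0.
Qed.

Lemma fcalc_positive f : (forall t, eps <= t -> 0 <= f t) -> positive_op (F f).
Proof.
move=> f0 x; rewrite dot_suml sumr_ge0 // => i _.
rewrite !dotZl (dotpC (e i)) mulrCA -normCK mulr_ge0 ?exprn_ge0 //.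
by rewrite -[X in X <= _]/((0 : R)%:C%C) lecR f0.
Qed.

(** The operator [a - eps] is positive on the range of [P]; Cauchy-Schwarz turns this bound on the
    quadratic form into one on the norm. *)
Lemma spectral_lower x : eps * hnorm (P x) <= hnorm (a (P x)).
Proof.
have [->|Px0] := eqVneq (hnorm (P x)) 0; first by rewrite mulr0 hnorm_ge0.
have Pp : 0 < hnorm (P x) by rewrite lt_neqAle eq_sym Px0 hnorm_ge0.
rewrite -(ler_pM2r Pp) (le_trans _ (rdot_le_hnorm _ _)) // -mulrA -expr2.
rewrite -rdot_norm -rdotZl -subr_ge0 -rdotNl -rdotDl.
have : positive_op (F (fun t => t - eps)).
  by apply: fcalc_positive => t; rewrite subr_ge0.
move=> /(_ (P x)); rewrite lecE => /andP[_] /=.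
congr (_ <= complex.Re (dotp _ _)).
rewrite -scaleNr -rmorphN -!fcalc1 op_fcalc fcalc_comp.
rewrite scaler_sumr -big_split; apply: eq_bigr => i _.
rewrite /= !scalerA -scalerDl; congr (_ *: _).
by rewrite !rmorphM rmorphB /= rmorphN /=; ring.
Qed.

End SpectralFamily.

(** A vector orthogonal to the kernel of [a] is a limit of vectors [a z], and for these the error is
    [a (z - P z)], of norm at most [eps] times that of [z]. The threshold [d] serves all spectral
    families at once, so finitely many vectors can share one. *)
Lemma spectral_approx H (a : H -> H) x (eta : R) :
  compact_op a -> positive_op a -> (forall z, a z = 0 -> dotp x z = 0) -> 0 < eta ->
  exists2 d : R, 0 < d & forall eps n (e : 'I_n -> H) l, 0 < eps -> eps <= d ->
    spectral_family a eps e l -> hnorm (x - finite_rank e e x) <= eta.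
Proof.
move=> ca pa xa eta0; have [la _] := ca; have aa := positive_op_adjoint la pa.
have sM : subspace (closure (range a)).
  apply: closure_subspace; first by exists 0 => //; rewrite linear_op0.
  by move=> c _ _ [y _ <-] [z _ <-]; exists (c *: y + z) => //; rewrite la.
have [p cp xp] := projection x sM.
have xpE : x - p = 0.
  have axp : a (x - p) = 0.
    apply: dotp_eq0P => y; rewrite aa; apply: xp; apply: subset_closure.
    by exists y.
  apply/hnorm_eq0/eqP; rewrite -sqrf_eq0; apply/eqP/(@complexI R).
  by rewrite -dotp_hnorm dotBl (xa _ axp) (dotp_swap0 (xp _ cp)) subrr.
have xM : closure (range a) x.
  by have -> : x = p by apply/eqP; rewrite -subr_eq0 xpE.
have [_ [z _ <-] zx] := closure_approx xM (divr_gt0 eta0 (ltr0Sn R 3)).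
have z1 : 0 < 2 * (hnorm z + 1) by rewrite mulr_gt0 // ltr_wpDl ?hnorm_ge0.
exists (eta / (2 * (hnorm z + 1))) => [|eps n e l e0 ed sf]; first exact: divr_gt0.
have [on _ _ _] := sf.
have lP : linear (finite_rank e e) by have [] := finite_rank_compact e e.
set P := finite_rank e e in lP *.
have -> : x - P x = (a z - P (a z)) - ((a z - x) - P (a z - x)).
  rewrite (linear_opD _ _ lP) (linear_opN _ lP).
  have E (u v p' q : H) : v - q = (u - p') - ((u - v) - (p' - q)).
    by rewrite (opprB (u - v)) (opprB u) addrA subrKA addrC subrKA.
  exact: E.
rewrite (le_trans (hnormD _ _)) // hnormN.
have h1 : hnorm (a z - P (a z)) <= eta / 2.
  have -> : P (a z) = a (P z).
    rewrite /P -(fcalc1 e l) -(fcalc1 e l z) (fcalc_op ca pa sf).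
    by rewrite (op_fcalc ca sf).
  rewrite -(linear_opN _ la) -(linear_opD _ _ la).
  rewrite (le_trans (spectral_tail ca pa e0 sf _)) //.
  rewrite (le_trans (ler_wpM2r (hnorm_ge0 z) ed)) //.
  rewrite mulrAC ler_pdivrMr //; have := hnorm_ge0 z; nra.
have h2 := onproj_compl_le on (a z - x).
move: zx h1 h2; lra.
Qed.

End FunctionalCalculus.

(** * Comparison of fixed positive elements *)

Section Representations.
Context (R : realType).
Implicit Types H K : hilbertType R.

(** A nonzero [x] in the kernel would give the positive functional sending [T] to [dotp (T x) x],
    which is 0 at [a] but not at the rank-one operator along [x]. *)
Lemma strictly_positive_inj H (a : H -> H) x :
  strictly_positive a -> a x = 0 -> x = 0.
Proof.
move=> [ca pa sa] ax0; apply/eqP/negPn/negP => x0.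
have x2 : dotp x x != 0 by rewrite dotp_norm sqrf_eq0 normr_eq0.
have := sa (fun T => dotp (T x) x); rewrite ax0 dot0l ltxx => h; suff : false by []; apply: h.
  split=> [c S T _ _|T _ pT]; last exact: (pT x).
  by rewrite -[(c *: S + T) x]/(c *: S x + T x) dotDl dotZl.
exists (fun y => dotp y x *: x); first exact: rank_one_compact.
by rewrite dotZl mulf_neq0.
Qed.

Lemma dotp_inj H (u v : H) : (forall y, dotp u y = dotp v y) -> u = v.
Proof.
move=> uv; apply/eqP; rewrite -subr_eq0; apply/eqP/dotp_eq0P => y.
by rewrite dotBl uv subrr.
Qed.

Lemma adjoint_sym H K (T : H -> K) S : adjoint T S -> adjoint S T.
Proof. by move=> TS x y; rewrite dotpC -TS -dotpC. Qed.

Definition isometric H K (U : H -> K) : Prop :=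
  forall x y, dotp (U x) (U y) = dotp x y.

Lemma isometric_hnorm H K (U : H -> K) x : isometric U -> hnorm (U x) = hnorm x.
Proof.
move=> iU; apply/eqP; rewrite -(@eqrXn2 _ 2) ?hnorm_ge0 //; apply/eqP.
by apply: (@complexI R); rewrite -!dotp_hnorm iU.
Qed.

Lemma isometric_range H K (U : H -> K) : linear U -> isometric U -> subspace (range U).
Proof.
move=> lU iU; split; last first.
- by move=> c _ _ [x _ <-] [y _ <-]; exists (c *: x + y); rewrite ?lU.
- by exists 0 => //; rewrite linear_op0.
apply: approx_closed => y yP.
have n0 n : 0 < n.+1%:R^-1 :> R by rewrite invr_gt0.
have /choice[u uP] n : exists x, hnorm (U x - y) <= n.+1%:R^-1.
  by have [_ [x _ <-] xy] := yP _ (n0 n); exists x.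
have [e e0|x xP] := @hcauchy_limit R H u.
  have [N NP] := invS_small (divr_gt0 e0 (ltr0Sn R 1)).
  exists N => m n /NP Nm /NP Nn; rewrite -(isometric_hnorm _ iU).
  rewrite linear_opD // linear_opN // (le_trans (hnormB_le _ y _)) //.
  rewrite [leRHS]splitr lerD ?(le_trans (uP _)) //.
  by rewrite hnormB_sym (le_trans (uP _)).
exists x => //; apply/eqP; rewrite -subr_eq0; apply/eqP/hnorm_eq0/eqP.
rewrite eq_le hnorm_ge0 andbT; apply/ler_addgt0Pr => e e0; rewrite add0r.
have [N NP] := invS_small (divr_gt0 e0 (ltr0Sn R 1)).
have [N' N'P] := xP (e / 2) (divr_gt0 e0 (ltr0Sn _ _)).
rewrite (le_trans (hnormB_le _ (U (u (maxn N N'))) _)) // [leRHS]splitr lerD //.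
  rewrite -linear_opN // -linear_opD // isometric_hnorm // hnormB_sym.
  by apply: N'P; rewrite leq_maxr.
by rewrite (le_trans (uP _)) // NP // leq_maxl.
Qed.

(** The adjoint is the orthogonal projection onto [range U], which is closed, followed by the
    inverse of [U]. *)
Lemma isometric_adjoint H K (U : H -> K) : linear U -> isometric U ->
  exists V, [/\ adjoint U V, cancel U V & bounded_op V].
Proof.
move=> lU iU; have sM := isometric_range lU iU.
have /choice[V VP] : forall y, exists x, orth (range U) (y - U x).
  by move=> y; have [_ [x _ <-] xP] := projection y sM; exists x.
have UV : adjoint U V.
  move=> x y; rewrite -(iU x) -[in LHS](subrK (U (V y)) y) dotDr.
  by rewrite (dotp_swap0 (VP y _ _)) ?add0r //; exists x.
exists V; split=> //; first by move=> x; apply: dotp_inj => y; rewrite (adjoint_sym UV) iU.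
by apply: adjoint_bounded UV _; exists 1; split=> // x; rewrite isometric_hnorm // mul1r.
Qed.

Context (G : topologicalGroupType).
Implicit Types mu nu : unitary_rep R G.

Lemma rep_linear mu g : linear (@rep_act _ _ mu g).
Proof. by have [] := rep_unitary mu g. Qed.

Lemma rep_isometric mu g : isometric (@rep_act _ _ mu g).
Proof. by have [] := rep_unitary mu g. Qed.

Lemma rep_actVK mu g (x : mu) : rep_act g (rep_act g^-1%g x) = x.
Proof. by rewrite -[LHS]/((rep_act g \o rep_act g^-1%g) x) -rep_actM mulgV rep_act1. Qed.

Lemma rep_adjoint mu g : adjoint (@rep_act _ _ mu g) (rep_act g^-1%g).
Proof. by move=> x y; rewrite -[in LHS](rep_actVK g y) rep_isometric. Qed.

Lemma adjoint_fixed mu nu (T : mu -> nu) S :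
  adjoint T S -> equivariant T -> equivariant S.
Proof.
move=> TS eT g x; apply: dotp_inj => y.
rewrite (adjoint_sym TS) rep_adjoint -eT -(adjoint_sym TS).
by rewrite -rep_adjoint.
Qed.

Lemma equivariant_fixed mu nu (T : mu -> nu) : equivariant T -> fixed_op T.
Proof. by move=> eT; apply: fixed_opP => g x; rewrite eT. Qed.

Lemma fixed_equivariant mu nu (T : mu -> nu) : fixed_op T -> equivariant T.
Proof. by move=> fT g x; rewrite fixed_opE. Qed.

Lemma fcalc_equivariant mu (a : mu -> mu) eps n (e : 'I_n -> mu) l f :
  compact_op a -> positive_op a -> equivariant a -> spectral_family a eps e l ->
  equivariant (fcalc e l f).
Proof.
move=> ca pa ea sf g x; apply: (fcalc_commute ca pa sf (h := rep_act g^-1%g)).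
- exact: rep_linear.
- exact: rep_adjoint.
- by move=> y; exact: ea.
- by move=> y; exact: ea.
Qed.

(* With alpha = a^(1/2) and beta = b^(-1/2) cut off to large eigenvalues, d is
   the adjoint of beta U alpha, so that d b d^* is close to alpha U^* U alpha. *)
Lemma cuntz_le_partial_isometry mu nu (a : fixed_positive mu) (b : fixed_positive nu)
    (U : mu -> nu) : linear U -> equivariant U ->
  (forall x y, dotp (U (a x)) (U (a y)) = dotp (a x) (a y)) ->
  (forall x z, b z = 0 -> dotp (U (a x)) z = 0) -> cuntz_le a b.
Proof.
move=> lU eU iU Ub; apply/cuntz_leP => eps eps0.
have [[ca fa] [cb fb]] := (fixed_positiveK a, fixed_positiveK b).
have [pa pb] := (@fixed_positive_ge0 _ _ _ a, @fixed_positive_ge0 _ _ _ b).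
have [la lb] := (proj1 ca, proj1 cb).
have [ea eb] := (fixed_equivariant fa, fixed_equivariant fb).
(* One half of [eps] pays for cutting off [a] at [eps / 2], the other for cutting off [b]. *)
have h0 : 0 < eps / 2 by rewrite divr_gt0.
have [n [e [l sf]]] := spectral_family_exists ca pa h0.
have [on ae le _] := sf.
have l0 i : 0 < l i by exact: lt_le_trans (le i).
pose w i : nu := (Num.sqrt (l i))%:C%C *: U (e i).
(* [T] is [U alpha]; the finite-rank form provides its adjoint [T'] although [U] is not assumed to
   have one. *)
pose T := finite_rank e w; pose T' := finite_rank w e.
have TT' : adjoint T T' by exact: finite_rank_adjoint.
have TE x : T x = U (fcalc e l Num.sqrt x).
  rewrite (linear_op_sum _ _ lU); apply: eq_bigr => i _.
  by rewrite (linear_opZ _ _ lU).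
have wE i : exists y, w i = U (a y).
  exists ((Num.sqrt (l i) / l i)%:C%C *: e i).
  rewrite (linear_opZ _ _ la) ae scalerA -rmorphM mulfVK ?gt_eqF //.
  by rewrite (linear_opZ _ _ lU).
have eT : equivariant T.
  by move=> g x; rewrite !TE (fcalc_equivariant _ ca pa ea sf) eU.
have cT' : compact_op T' by exact: finite_rank_compact.
have [M [M0 bM]] := compact_op_bounded cT'.
have n1 : 0 < n.+1%:R :> R by [].
(* [M] absorbs the norm of [T'], and [n.+1] the sum over the [n] vectors [w i], also when
   [n = 0]. *)
have eta0 : 0 < eps / 2 / M / n.+1%:R by rewrite !divr_gt0.
have /choice[D DP] : forall i, exists d : R, 0 < d /\
    forall eps' m (f : 'I_m -> nu) k, 0 < eps' -> eps' <= d ->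
    spectral_family b eps' f k ->
    hnorm (w i - finite_rank f f (w i)) <= eps / 2 / M / n.+1%:R.
  move=> i; have [|d d0 dP] := @spectral_approx _ _ b (w i) _ cb pb _ eta0.
    by have [y ->] := wE i; exact: Ub.
  by exists d.
pose d0 := \big[Num.min/1]_i D i.
have d0_gt0 : 0 < d0.
  by apply/bigmin_gtP; split=> // i _; have [] := DP i.
have [m [f [k sg]]] := spectral_family_exists cb pb d0_gt0.
have [og bf le_k _] := sg.
pose beta := fcalc f k (fun t => (Num.sqrt t)^-1).
have lbeta : linear beta by exact: fcalc_linear.
have bbeta : bounded_op beta.
  by apply: compact_op_bounded; exact: finite_rank_compact.
have ebeta : equivariant beta by exact: fcalc_equivariant cb pb eb sg.
have dds : adjoint (T' \o beta) (beta \o T).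
  by move=> x y /=; rewrite (adjoint_sym TT') fcalc_adjoint.
exists (T' \o beta), (beta \o T); split=> //.
  split; first exact: compact_op_comp.
  apply: equivariant_fixed; apply: (adjoint_fixed (adjoint_sym dds)).
  by move=> g x /=; rewrite eT ebeta.
move=> x /=.
have -> : beta (b (beta (T x))) = finite_rank f f (T x).
  rewrite /beta (op_fcalc cb sg) (fcalc_comp sg) -(fcalc1 f k).
  apply: (fcalc_ext sg) => t tk; have t0 : 0 < t by exact: lt_le_trans tk.
  rewrite mulrA mulrAC -invfM -expr2 sqr_sqrtr ?(ltW t0) // mulVf ?gt_eqF //.
(* This is [alpha U^* U alpha = alpha^2]. The hypothesis on [U] covers only the range of [a], so
   values of [alpha] are first rewritten as values of [a]. *)
have aP : T' (T x) = a (finite_rank e e x).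
  apply: dotp_inj => y; rewrite (adjoint_sym TT') !TE.
  have ran z : exists z', fcalc e l Num.sqrt z = a z'.
    exists (fcalc e l (fun t => Num.sqrt t / t) z).
    rewrite (op_fcalc ca sf); apply: (fcalc_ext sf) => t tk.
    by rewrite mulrC mulfVK // gt_eqF // (lt_le_trans h0).
  have [[x' xE] [y' yE]] := (ran x, ran y).
  rewrite xE yE iU -xE -yE -(fcalc_adjoint e l) -(fcalc1 e l) (op_fcalc ca sf).
  rewrite (fcalc_comp sf); congr (dotp _ y); apply: (fcalc_ext sf) => t tk.
  by rewrite mulr1 -expr2 sqr_sqrtr // ltW // (lt_le_trans h0).
set P := finite_rank f f.
have lT' : linear T' by case: cT'.
have -> : T' (P (T x)) - a x = T' (P (T x) - T x) + (a (finite_rank e e x) - a x).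
  by rewrite (linear_opD _ _ lT') (linear_opN _ lT') aP addrA subrK.
rewrite (le_trans (hnormD _ _)) // [eps in leRHS]splitr mulrDl lerD //; last first.
  rewrite hnormB_sym -(linear_opN _ la) -(linear_opD _ _ la).
  exact: (spectral_tail ca pa h0 sf).
rewrite (le_trans (bM _)) // mulrC -ler_pdivlMr // hnormB_sym.
have lP : linear P by have [] := finite_rank_compact f f.
have -> : T x - P (T x) = \sum_i dotp x (e i) *: (w i - P (w i)).
  rewrite {2}/T (linear_op_sum _ _ lP) -sumrB.
  by apply: eq_bigr => i _; rewrite scalerBr.
rewrite (le_trans (hnorm_sum _ _ _)) //.
apply: (@le_trans _ _ (\sum_(i < n) hnorm x * (eps / 2 / M / n.+1%:R))).
  apply: ler_sum => i _; rewrite (le_trans (hnorm_dotZ _ _ _)) //.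
  rewrite orthonormal_hnorm // mulr1 ler_wpM2l ?hnorm_ge0 //; have [_ Dd] := DP i.
  by apply: Dd sg => //; exact: bigmin_inf (lexx _).
rewrite sumr_const card_ord -mulrnAr mulrC [leRHS]mulrAC ler_wpM2r ?hnorm_ge0 //.
by rewrite -mulr_natr mulrAC ler_pdivrMr // ler_pM2l ?divr_gt0 // ler_nat.
Qed.

End Representations.

(** * Antisymmetry of the order on representations *)

Section SchroederBernstein.
Context (R : realType) (G : topologicalGroupType).
Implicit Types mu nu : unitary_rep R G.

(* Hilbert space version of the set-theoretic argument: with T = W V and N the
   orthogonal complement of all T^n ((range W)^perp), the map that is the
   identity on N and T on the complement of N is a unitary onto range W. *)
Lemma rep_le_antisym mu nu : rep_le mu nu -> rep_le nu mu -> rep_equiv mu nu.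
Proof.
move=> [_ [_ [V [[lV iV _] eV]]]] [_ [_ [W [[lW iW _] eW]]]].
pose T := W \o V.
have lT : linear T by move=> c x y; rewrite /T /= lV lW.
have iT : isometric T by move=> x y; rewrite /T /= iW iV.
have eT : equivariant T by move=> g x; rewrite /T /= eV eW.
have [Ts [TTs TsK _]] := isometric_adjoint lT iT.
have TsT := adjoint_sym TTs.
have lTs := adjoint_linear TTs.
have sW := isometric_range lW iW.
pose D := [set y | exists n z, orth (range W) z /\ y = iter n T z].
pose N := orth D.
have sN : subspace N by exact: orth_subspace.
have sNo : subspace (orth N) by exact: orth_subspace.
have N0 x z : N x -> orth (range W) z -> dotp x z = 0.
  by move=> Nx Wz; apply: Nx; exists 0%N, z.
have NTs x : N x -> N (Ts x).
  by move=> Nx _ [n [z [Wz ->]]]; rewrite TsT; apply: Nx; exists n.+1, z.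
have NT x : N x -> N (T x).
  move=> Nx _ [[|n] [z [Wz ->]]] /=.
    by apply: dotp_swap0; apply: Wz; exists (V x).
  by rewrite iT; apply: Nx; exists n, z.
have oT x : orth N x -> orth N (T x).
  by move=> Nx y Ny; rewrite TTs; apply: Nx; exact: NTs.
have oTs x : orth N x -> orth N (Ts x).
  by move=> Nx y Ny; rewrite TsT; apply: Nx; exact: NT.
have Ng g x : N x -> N (rep_act g x).
  move=> Nx _ [n [z [Wz ->]]]; rewrite rep_adjoint.
  have -> : rep_act g^-1%g (iter n T z) = iter n T (rep_act g^-1%g z).
    by elim: n => //= n <-; rewrite eT.
  apply: Nx; exists n, (rep_act g^-1%g z); split=> // _ [y _ <-].
  by rewrite rep_adjoint -eW; apply: Wz; eexists.
have og g x : orth N x -> orth N (rep_act g x).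
  by move=> Nx y Ny; rewrite rep_adjoint; apply: Nx; exact: Ng.
have /choice[p pP] : forall x, exists u, N u /\ orth N (x - u).
  by move=> x; have [u] := projection x sN; exists u.
have p_uniq u v : N u -> orth N v -> p (u + v) = u.
  move=> Nu Nv; have [Np No] := pP (u + v).
  apply/eqP; rewrite -subr_eq0; apply/eqP.
  have h1 : N (p (u + v) - u) by exact: (subspaceB sN).
  have h2 : orth N (p (u + v) - u).
    have -> : p (u + v) - u = v - (u + v - p (u + v)).
      by rewrite opprB addrCA opprD (addrCA v) subrr addr0.
    exact: (subspaceB sNo).
  apply/hnorm_eq0/eqP; rewrite -sqrf_eq0; apply/eqP/(@complexI R).
  by rewrite -dotp_hnorm h2.
have lp : linear p.
  move=> c x y; rewrite -[in LHS](subrK (p x) x) -[in LHS](subrK (p y) y).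
  have [[Nx Nx'] [Ny Ny']] := (pP x, pP y).
  rewrite scalerDr addrACA addrC; apply: p_uniq; first by case: sN => _ _ h; exact: h.
  by case: sNo => _ _ h; exact: h.
have ep g x : p (rep_act g x) = rep_act g (p x).
  have [Nx Nx'] := pP x.
  rewrite -[in LHS](subrK (p x) x) linear_opD; last exact: rep_linear.
  by rewrite addrC; apply: p_uniq; [exact: Ng|exact: og].
have [q qE] : {q : mu -> mu | forall x, q x = x - p x} by exists (fun x => x - p x).
have qN x : orth N (q x) by rewrite qE; have [] := pP x.
have pN x : N (p x) by have [] := pP x.
pose U x := p x + T (q x).
have iU : isometric U.
  move=> x y; rewrite /U !dotDl !dotDr iT.
  rewrite (oT _ (qN x) _ (pN y)) (dotp_swap0 (oT _ (qN y) _ (pN x))).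
  rewrite add0r addr0 -[in RHS](subrK (p x) x) -[in RHS](subrK (p y) y).
  rewrite -!qE !dotDl !dotDr (qN x _ (pN y)).
  by rewrite (dotp_swap0 (qN y _ (pN x))) addr0 add0r addrC.
have lU : linear U.
  move=> c x y; rewrite /U !qE lp opprD addrACA -scalerBr lT.
  by rewrite scalerDr addrACA.
have eU : equivariant U.
  move=> g x; have lg := @rep_linear _ _ mu g.
  by rewrite /U !qE ep -(linear_opN _ lg) -(linear_opD _ _ lg) eT (linear_opD _ _ lg).
have UW : range U = range W.
  apply/seteqP; split=> [_ [x _ <-]|_ [y _ <-]].
    apply: (subspaceD sW); last by exists (V (q x)).
    rewrite -(orth_orth sW) => z Wz; exact: N0.
  (* The preimage of [w] is [p w + T^* (q w)], provided [T T^* (q w) = q w]. The difference of these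
     two lies in [orth N], and also in [N]: it is orthogonal to [(range W)^perp] because [w] lies in
     [range W], and to the range of [T] because [T^* T = 1]. *)
  set w := W y; have [Nw Nw'] := (pN w, qN w).
  pose k := Ts (q w).
  have kN : orth N k by exact: oTs.
  suff Tk : T k = q w.
    exists (p w + k) => //; rewrite /U qE p_uniq // (addrC _ k) addrK Tk.
    by rewrite qE addrC subrK.
  have h1 : orth N (q w - T k) by apply: (subspaceB sNo) => //; exact: oT.
  have h2 : N (q w - T k).
    move=> _ [[|n] [z [Wz ->]]] /=.
      rewrite dotBl qE dotBl (N0 _ _ Nw Wz) (dotp_swap0 (Wz w _)); last by exists y.
      by rewrite (dotp_swap0 (Wz (T k) _)) ?subrr ?subr0 //; exists (V k).
    by rewrite dotBl iT /k TsT subrr.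
  apply/esym/eqP; rewrite -subr_eq0; apply/eqP/hnorm_eq0/eqP.
  rewrite -sqrf_eq0; apply/eqP/(@complexI R).
  by rewrite -dotp_hnorm h1.
have /choice[F FP] : forall x, exists y, W y = U x.
  by move=> x; have [y _ yx] : range W (U x) by [rewrite -UW; exists x]; exists y.
have Wi := isometry_inj lW iW.
exists F; split; first split.
- by move=> c x y; apply: Wi; rewrite lW !FP lU.
- by move=> x y; rewrite -iW !FP; exact: iU.
- apply/seteqP; split=> // y _; have : range U (W y) by rewrite UW; exists y.
  by move=> [x _ xy]; exists x => //; apply: Wi; rewrite FP.
- by move=> g x; apply: Wi; rewrite eW !FP eU.
Qed.

End SchroederBernstein.

(** * Generic injectivity of linear perturbations *)

Section GenericPerturbation.
Context (R : realType).
Implicit Types H K : hilbertType R.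

(** Pairing [u x + t L x = 0] with the vectors [L (e j)] gives [c (A + t D) = 0] for the coordinate
    row [c] of [x]. The Gram matrix [D] is invertible since [L] is injective on the span, so a bad
    [t] is the negative of an eigenvalue of [A D^(-1)], and there are finitely many of these. *)
Lemma generic_injective H K n (e : 'I_n -> H) (u L : H -> K) (tau : R) :
  linear u -> linear L -> orthonormal_family e ->
  (forall x, finite_rank e e x = x -> L x = 0 -> x = 0) -> 0 < tau ->
  exists t : R, [/\ 0 < t, t <= tau &
    forall x, finite_rank e e x = x -> u x + t%:C%C *: L x = 0 -> x = 0].
Proof.
move=> lu lL on Linj tau0.
pose A : 'M[R[i]]_n := \matrix_(i, j) dotp (u (e i)) (L (e j)).
pose D : 'M[R[i]]_n := \matrix_(i, j) dotp (L (e i)) (L (e j)).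
pose vec (c : 'rV[R[i]]_n) : H := \sum_i c ord0 i *: e i.
have vecP c : finite_rank e e (vec c) = vec c.
  apply: eq_bigr => i _; congr (_ *: _).
  rewrite dot_suml (bigD1 i) //= big1 ?addr0 => [|j ji].
    by rewrite dotZl on eqxx mulr1.
  by rewrite dotZl on (negbTE ji) mulr0.
have vec0 c : vec c = 0 -> c = 0.
  move=> c0; apply/rowP => i; rewrite !mxE.
  rewrite -[RHS](dot0l (e i)) -c0 dot_suml (bigD1 i) //= big1 ?addr0 => [|j ji].
    by rewrite dotZl on eqxx mulr1.
  by rewrite dotZl on (negbTE ji) mulr0.
have mulE (T : H -> K) (c : 'rV[R[i]]_n) j : linear T ->
    (c *m \matrix_(i, j) dotp (T (e i)) (L (e j))) ord0 j = dotp (T (vec c)) (L (e j)).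
  move=> lT; rewrite linear_op_sum // dot_suml mxE; apply: eq_bigr => i _.
  by rewrite mxE dotZl.
have Du : D \in unitmx.
  rewrite -row_free_unit; apply: inj_row_free => c cD; apply/vec0/Linj => //.
  have Lc j : dotp (L (vec c)) (L (e j)) = 0 by rewrite -mulE // -/D cD mxE.
  apply: dotp_eq0P => y; have : dotp (L (vec c)) (L (vec c)) = 0.
    rewrite [in X in dotp _ X](linear_op_sum _ _ lL) dot_sumr big1 // => i _.
    by rewrite dotZr Lc mulr0.
  by move=> /eqP; rewrite dotp_norm sqrf_eq0 normr_eq0 => /eqP ->; rewrite dot0l.
pose p := char_poly (A *m invmx D).
have p0 : p != 0 by rewrite monic_neq0 // char_poly_monic.
pose t k : R := tau / k.+1%:R.
have tau_neq0 : tau != 0 by rewrite gt_eqF.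
(* The numbers [tau / (k + 1)] are distinct, and a nonzero polynomial has fewer roots than its
   size. *)
have [k pk] : exists k, ~~ root p (- (t k)%:C%C).
  apply/not_existsP => pt.
  have := @max_poly_roots _ p [seq - (t k)%:C%C | k <- iota 0 (size p)] p0.
  rewrite size_map size_iota ltnn => h; suff : false by []; apply: h.
    by apply/allP => _ /mapP[k _ ->]; apply/negPn/negP; exact: pt.
  rewrite map_inj_uniq ?iota_uniq // => i j /oppr_inj/complexI.
  move/(mulfI tau_neq0)/invr_inj/eqP.
  by rewrite eqr_nat => /eqP[].
have tk0 : 0 < t k by rewrite divr_gt0.
exists (t k); split=> //.
  by rewrite ler_pdivrMr // ler_peMr ?(ltW tau0) // ler1n.
move=> x Px xt; apply: contraNeq pk => x0.
pose c : 'rV[R[i]]_n := \row_i dotp x (e i).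
have xE : x = vec c by rewrite -Px; apply: eq_bigr => i _; rewrite mxE.
rewrite -eigenvalue_root_char; apply/eigenvalueP; exists c; last first.
  by apply: contra_neq x0 => c0; rewrite xE c0 /vec big1 // => i _; rewrite mxE scale0r.
have cA : c *m A = - (t k)%:C%C *: (c *m D).
  apply/rowP => j; rewrite mulE // [RHS]mxE mulE // -xE.
  apply/eqP; rewrite -subr_eq0 mulNr opprK -dotZl -dotDl xt dot0l //.
by rewrite mulmxA cA -scalemxAl mulmxK.
Qed.

(** Polarization: the norm of [x + y] recovers the real part of the inner product, and replacing [x]
    by ['i x] recovers the imaginary part. *)
Lemma isometric_of_hnorm H K (U : H -> K) :
  linear U -> (forall x, hnorm (U x) = hnorm x) -> isometric U.
Proof.
move=> lU nU.
have rU x y : rdot (U x) (U y) = rdot x y.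
  have := nU (x + y) => /(congr1 (fun t => t ^+ 2)).
  rewrite linear_opD // -!rdot_norm !(rdotDl, rdotDr) !rdot_norm !nU.
  rewrite (rdotC (U y)) (rdotC y); lra.
move=> x y; apply/eqP; rewrite eq_complex; apply/andP; split; apply/eqP.
  exact: rU.
have ImE (L : hilbertType R) (z w : L) : complex.Im (dotp z w) = - rdot ('i%C *: z) w.
  by rewrite /rdot dotZl; case: (dotp z w) => s r /=; ring.
by rewrite !ImE -linear_opZ // rU.
Qed.


End GenericPerturbation.

(** * Equivariant partial isometries close to a given one *)

Section PolarPerturbation.
Context (R : realType) (G : topologicalGroupType).
Implicit Types mu nu : unitary_rep R G.

(** Applied to [y = x - s x], this bounds the distance from [x] to [s x] by that from [x] to
    [s (s x)], so no estimate on a square root is needed. *)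
Lemma le_hnorm_add_pos (H : hilbertType R) (s : H -> H) (y : H) :
  positive_op s -> hnorm y <= hnorm (y + s y).
Proof.
move=> ps; rewrite -ler_sqr ?nnegrE ?hnorm_ge0 // -[leRHS]rdot_norm.
rewrite !(rdotDl, rdotDr) (rdotC y (s y)) !rdot_norm.
have : 0 <= rdot (s y) y by have := ps y; rewrite lecE => /andP[].
have := sqr_ge0 (hnorm (s y)); lra.
Qed.

(* v is the isometric part in the polar decomposition of (u + t L) P, for a
   generic small t; it is close to u where u is isometric. *)
Lemma polar_perturbation mu nu n (e : 'I_n -> mu) (u L : mu -> nu) u' L' (eta : R) :
  orthonormal_family e -> equivariant (finite_rank e e) ->
  linear u -> bounded_op u -> equivariant u -> adjoint u u' ->
  linear L -> bounded_op L -> equivariant L -> adjoint L L' ->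
  (forall x, finite_rank e e x = x -> L x = 0 -> x = 0) -> 0 < eta ->
  exists v v', [/\ [/\ linear v, equivariant v & adjoint v v'],
    forall x, v' (v x) = finite_rank e e x &
    forall x, finite_rank e e x = x -> u' (u x) = x ->
      hnorm (v x - u x) <= eta * hnorm x].
Proof.
move=> on eP lu bu eu uu' lL bL eL LL' Linj eta0.
set P := finite_rank e e in eP Linj *.
have [bu' bL'] := (adjoint_bounded uu' bu, adjoint_bounded LL' bL).
have [lu' lL'] := (adjoint_linear uu', adjoint_linear LL').
have lP : linear P by have [] := finite_rank_compact e e.
have PP x : P (P x) = P x by exact: onproj_id.
have PA : adjoint P P by exact: onproj_adjoint.
have [B [B1 [uB LB u'B L'B]]] : exists B : R, 1 <= B /\
    [/\ forall x, hnorm (u x) <= B * hnorm x, forall x, hnorm (L x) <= B * hnorm x,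
        forall x, hnorm (u' x) <= B * hnorm x & forall x, hnorm (L' x) <= B * hnorm x].
  have [[B1 [B10 b1]] [B2 [B20 b2]]] := (bu, bL).
  have [[B3 [B30 b3]] [B4 [B40 b4]]] := (bu', bL').
  have le_trans' (H K : hilbertType R) (T : H -> K) (b c : R) :
      b <= c -> (forall x, hnorm (T x) <= b * hnorm x) ->
      forall x, hnorm (T x) <= c * hnorm x.
    by move=> bc Tb x; rewrite (le_trans (Tb x)) // ler_wpM2r // hnorm_ge0.
  exists (1 + B1 + B2 + B3 + B4); split; first by lra.
  by split; [apply: le_trans' b1|apply: le_trans' b2|apply: le_trans' b3|
             apply: le_trans' b4]; lra.
have B0 : 0 < B by exact: lt_le_trans B1.
(* The final error is at most [4 t B^2] times the norm of [x]: three terms from [C x - x], where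
   [t <= 1] is used, and one from [t L x], where [B <= B^2]. *)
have tau0 : 0 < Num.min 1 (eta / (4 * B ^+ 2)).
  by rewrite lt_min ltr01 divr_gt0 // mulr_gt0 // exprn_gt0.
have [t [t0 + tinj]] := generic_injective lu lL on Linj tau0.
rewrite le_min => /andP[t1 teta].
pose w i := u (e i) + t%:C%C *: L (e i).
pose Q := finite_rank e w; pose Q' := finite_rank w e.
have QE x : Q x = u (P x) + t%:C%C *: L (P x).
  rewrite (linear_op_sum _ _ lu) (linear_op_sum _ _ lL) scaler_sumr -big_split.
  by apply: eq_bigr => i _; rewrite /w scalerDr !scalerA (mulrC t%:C%C).
have QQ' : adjoint Q Q' by exact: finite_rank_adjoint.
have lQ : linear Q by have [] := finite_rank_compact e w.
have lQ' : linear Q' by have [] := finite_rank_compact w e.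
have eQ : equivariant Q.
  move=> g x; rewrite !QE eP eu eL; have lg := @rep_linear _ _ nu g.
  by rewrite (linear_opD _ _ lg) (linear_opZ _ _ lg).
have eQ' : equivariant Q' by exact: adjoint_fixed QQ' eQ.
have QP x : Q (P x) = Q x by rewrite !QE PP.
have PQ' x : P (Q' x) = Q' x.
  by apply: dotp_inj => y; rewrite PA !(adjoint_sym QQ') QP.
have Qinj x : P x = x -> Q x = 0 -> x = 0 by move=> Px; rewrite QE Px; exact: tinj.
pose C := Q' \o Q.
have cC : compact_op C.
  apply: compact_op_comp; [exact: finite_rank_compact|exact: lQ|].
  by apply: compact_op_bounded; exact: finite_rank_compact.
have pC : positive_op C.
  by move=> x; rewrite (adjoint_sym QQ') dotp_norm exprn_ge0.
have eC : equivariant C by move=> g x; rewrite /C /= eQ eQ'.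
have C0 x : C x = 0 -> Q x = 0.
  move=> Cx; apply/eqP; rewrite -normr_eq0 -sqrf_eq0 -dotp_norm.
  by rewrite -(adjoint_sym QQ') (Cx : Q' (Q x) = 0) dot0l.
(* The level is so low that the spectral subspace of [C] is the whole range of [P]: a [y] in that
   range orthogonal to it is the sum of the [dotp y (e i) *: (e i - S (e i))], so its norm is at
   most [n / (n + 1)] times itself, and [y = 0]. *)
have [eps eps0 sC] : exists2 eps : R, 0 < eps &
    forall m (f : 'I_m -> mu) k, spectral_family C eps f k ->
    forall i, hnorm (e i - finite_rank f f (e i)) <= n.+1%:R^-1.
  have /choice[D DP] : forall i, exists d : R, 0 < d /\
      forall eps m (f : 'I_m -> mu) k, 0 < eps -> eps <= d ->
      spectral_family C eps f k ->
      hnorm (e i - finite_rank f f (e i)) <= n.+1%:R^-1.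
    move=> i; have [|//|d d0 dP] := @spectral_approx _ _ C (e i) n.+1%:R^-1 cC pC.
      move=> z /C0; rewrite -QP => /(Qinj _ (PP z)) Pz.
      have <- : P (e i) = e i.
        rewrite /P /finite_rank (bigD1 i) //= on eqxx scale1r big1 ?addr0 // => j ji.
        by rewrite on eq_sym (negbTE ji) scale0r.
      by rewrite PA Pz dot0r.
    by exists d.
  exists (\big[Num.min/1]_i D i).
    by apply/bigmin_gtP; split=> // i _; have [] := DP i.
  move=> m f k sf i; have [_ Dd] := DP i; apply: Dd sf => //.
    by apply/bigmin_gtP; split=> // j _; have [] := DP j.
  exact: bigmin_inf (lexx _).
have [m [f [k sf]]] := spectral_family_exists cC pC eps0.
have [of_ Cf le_k _] := sf.
pose S := finite_rank f f.
have lS : linear S by have [] := finite_rank_compact f f.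
have Pf i : P (f i) = f i.
  have k0 : 0 < k i by exact: lt_le_trans (le_k i).
  have -> : f i = (k i)^-1%:C%C *: C (f i).
    rewrite Cf scalerA -rmorphM /= mulVf ?gt_eqF //.
    by rewrite -[_%:C%C]/(1 : R[i]) scale1r.
  by rewrite (linear_opZ _ _ lP) PQ'.
have PS x : P (S x) = S x.
  rewrite (linear_op_sum _ _ lP); by apply: eq_bigr => i _; rewrite Pf.
have Sid x : P x = x -> S x = x.
  move=> Px; pose y := x - S x.
  have Py : P y = y by rewrite (linear_opD _ _ lP) (linear_opN _ lP) PS Px.
  have Sy : S y = 0.
    by rewrite (linear_opD _ _ lS) (linear_opN _ lS) /S onproj_id // subrr.
  suff y0 : hnorm y <= 0.
    apply/esym/eqP; rewrite -subr_eq0; apply/eqP/hnorm_eq0/eqP.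
    by rewrite eq_le y0 hnorm_ge0.
  have yE : y = \sum_i dotp y (e i) *: (e i - S (e i)).
    transitivity (P y - S (P y)); first by rewrite Py Sy subr0.
    rewrite /P /finite_rank (linear_op_sum _ _ lS) -sumrB.
    by apply: eq_bigr => i _; rewrite scalerBr.
  have yn : hnorm y <= n%:R / n.+1%:R * hnorm y.
    rewrite {1}yE (le_trans (hnorm_sum _ _ _)) //.
    apply: (@le_trans _ _ (\sum_(i < n) hnorm y / n.+1%:R)).
      apply: ler_sum => i _; rewrite (le_trans (hnorm_dotZ _ _ _)) //.
      by rewrite orthonormal_hnorm // mulr1 ler_wpM2l ?hnorm_ge0 //; exact: sC sf i.
    by rewrite sumr_const card_ord -[_ *+ n]mulr_natl mulrA mulrAC.
  have n1 : 0 < n.+1%:R :> R by [].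
  move: yn; rewrite mulrAC ler_pdivlMr // mulrC -subr_ge0 -mulrBl.
  by rewrite -natr1 opprD addrA subrr add0r mulN1r oppr_ge0.
have SP x : S x = P x.
  rewrite -[in LHS](subrK (P x) x) (linear_opD _ _ lS) (Sid (P x)) //.
  rewrite /S onproj_eq0 ?add0r // => i.
  by rewrite -Pf -PA (linear_opD _ _ lP) (linear_opN _ lP) PP subrr dot0l.
(* On the range of [P], [r] is [C^(-1/2)] and [s] is [C^(1/2)]; the polar decomposition of [Q] is
   [(Q r) s]. *)
pose r := fcalc f k (fun t => (Num.sqrt t)^-1).
pose s := fcalc f k Num.sqrt.
have lr : linear r by exact: fcalc_linear.
have rr : adjoint r r by exact: fcalc_adjoint.
exists (Q \o r), (r \o Q'); split.
- split; first by move=> c x y; rewrite /= lr lQ.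
    move=> g x; rewrite /= -eQ; congr Q.
    exact: fcalc_equivariant cC pC eC sf g x.
  by move=> x y /=; rewrite QQ' rr.
- move=> x /=; rewrite -[Q' _]/(C (r x)) /r (op_fcalc cC sf) (fcalc_comp sf).
  rewrite -SP /S -(fcalc1 f k); apply: (fcalc_ext sf) => z zk.
  have z0 : 0 < z by exact: lt_le_trans zk.
  by rewrite mulrCA -invfM -expr2 sqr_sqrtr ?(ltW z0) // mulfV ?gt_eqF.
move=> x Px ux.
have rs : r (s x) = x.
  rewrite /r /s (fcalc_comp sf) -[RHS]Px -SP /S -(fcalc1 f k); apply: (fcalc_ext sf) => z zk.
  by rewrite mulVf // gt_eqF // sqrtr_gt0 (lt_le_trans eps0).
have ss : s (s x) = C x.
  rewrite /s (fcalc_comp sf) -[in RHS]Px -SP /S -(fcalc1 f k) (op_fcalc cC sf).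
  apply: (fcalc_ext sf) => z zk; rewrite mulr1 -expr2 sqr_sqrtr //.
  by rewrite ltW // (lt_le_trans eps0).
have ps : positive_op s by apply: (fcalc_positive sf) => z _; exact: sqrtr_ge0.
have ls : linear s by exact: fcalc_linear.
(* Since [r (s x) = x], the map [Q r] sends [s x] to [Q x = u x + t L x]. What remains is governed
   by [x - s x], because [Q r] is a contraction. *)
have vE : Q (r x) - u x = Q (r (x - s x)) + t%:C%C *: L x.
  rewrite (linear_opD _ _ lr) (linear_opN _ lr) rs.
  rewrite (linear_opD _ _ lQ) (linear_opN _ lQ) (QE x) Px.
  by rewrite opprD addrA subrK.
have vn y : hnorm (Q (r y)) <= hnorm y.
  rewrite (le_trans _ (onproj_le on y)) // -/(P y).
  rewrite -ler_sqr ?nnegrE ?hnorm_ge0 //.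
  suff -> : hnorm (Q (r y)) ^+ 2 = hnorm (P y) ^+ 2 by [].
  apply: (@complexI R); rewrite -!dotp_hnorm QQ' rr.
  rewrite -[Q' _]/(C (r y)) /r (op_fcalc cC sf) (fcalc_comp sf).
  rewrite PA PP -SP /S -(fcalc1 f k); congr (dotp y _); apply: (fcalc_ext sf) => z zk.
  have z0 : 0 < z by exact: lt_le_trans zk.
  by rewrite mulrCA -invfM -expr2 sqr_sqrtr ?(ltW z0) // mulfV ?gt_eqF.
have h1 : hnorm (x - s x) <= hnorm (C x - x).
  rewrite (le_trans (le_hnorm_add_pos _ ps)) // (linear_opD _ _ ls) (linear_opN _ ls).
  by rewrite addrA subrK ss hnormB_sym.
have Q'E y : Q' y = P (u' y + t%:C%C *: L' y).
  apply: dotp_inj => z; rewrite (adjoint_sym QQ') QE PA dotDl dotDr dotZl dotZr.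
  rewrite (adjoint_sym uu') (adjoint_sym LL').
  by have -> : Num.conj t%:C%C = t%:C%C :> R[i] by exact: conjc_real.
(* Expanding [(u + t L)^* (u + t L) x], the term of order 0 is [u' (u x) = x], which cancels and
   leaves a factor [t]. *)
have h2 : hnorm (C x - x) <= t * (3 * B ^+ 2) * hnorm x.
  have -> : C x - x = t%:C%C *: P (u' (L x) + L' (u x) + t%:C%C *: L' (L x)).
    rewrite /C /= Q'E QE Px (linear_opD _ _ lu') (linear_opZ _ _ lu') ux.
    rewrite (linear_opD _ _ lL') (linear_opZ _ _ lL') -(linear_opZ _ _ lP).
    rewrite -addrA (linear_opD x _ lP) Px addrAC subrr add0r; congr P.
    by rewrite -scalerDr addrA.
  rewrite hnormZ ger0_norm ?(ltW t0) // -mulrA ler_pM2l //.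
  rewrite (le_trans (onproj_le on _)) // (le_trans (hnormD _ _)) //.
  have b1 := le_trans (u'B _) (ler_wpM2l (ltW B0) (LB x)).
  have b2 := le_trans (L'B _) (ler_wpM2l (ltW B0) (uB x)).
  have b3 := le_trans (L'B _) (ler_wpM2l (ltW B0) (LB x)).
  have b4 : hnorm (t%:C%C *: L' (L x)) <= hnorm (L' (L x)).
    by rewrite hnormZ ger0_norm ?(ltW t0) // ler_piMl ?hnorm_ge0.
  have := hnormD (u' (L x)) (L' (u x)).
  move: b1 b2 b3 b4; rewrite expr2; set X := hnorm _; set Y := hnorm _.
  lra.
rewrite /= vE (le_trans (hnormD _ _)) // hnormZ ger0_norm ?(ltW t0) //.
apply: (@le_trans _ _ (t * (4 * B ^+ 2) * hnorm x)); last first.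
  by rewrite ler_wpM2r ?hnorm_ge0 // -ler_pdivlMr // mulr_gt0 // exprn_gt0.
have h3 := le_trans (vn _) (le_trans h1 h2).
have h4 : t * hnorm (L x) <= t * (B ^+ 2 * hnorm x).
  rewrite ler_pM2l // (le_trans (LB x)) // ler_wpM2r ?hnorm_ge0 //.
  by rewrite expr2 ler_peMl // ltW.
move: h3 h4; lra.
Qed.

End PolarPerturbation.

(** * From Cuntz comparison to an embedding of representations *)

Section CuntzLeRepLe.
Context (R : realType) (G : topologicalGroupType).
Implicit Types mu nu : unitary_rep R G.

Lemma half_expr_le n : 2^-1 ^+ n <= n.+1%:R^-1 :> R.
Proof.
rewrite exprVn lef_pV2 ?posrE ?exprn_gt0 // -natrX ler_nat.
exact: ltn_expl.
Qed.

Lemma hnorm_cvg (H : hilbertType R) (u : nat -> H) l :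
  (forall e : R, 0 < e -> exists N, forall n, (N <= n)%N -> hnorm (u n - l) <= e) ->
  u @ \oo --> l.
Proof.
move=> ul; apply/cvgrPdist_le => _ /gtr0_complexP[e e0 ->].
have [N NP] := ul e e0; exists N => // n /= /NP.
by rewrite -hnormE lecR hnormB_sym.
Qed.

Lemma isometric_rep_le mu nu (U : mu -> nu) :
  linear U -> isometric U -> equivariant U -> rep_le mu nu.
Proof.
move=> lU iU eU; have [clM M0 lM] := isometric_range lU iU.
exists (range U); split; last by exists U.
by split=> // g _ [x _ <-]; exists (rep_act g x) => //; rewrite eU.
Qed.

(* Embeddings of the finite-dimensional spectral subspaces of a need not extend
   each other; they are corrected so that the k-th one differs from the next
   by at most 2^-k, and then converge to an embedding of mu. *)
Lemma cuntz_le_rep_le mu nu (a : fixed_positive mu) (b : fixed_positive nu) :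
  (forall x, a x = 0 -> x = 0) -> cuntz_le a b -> rep_le mu nu.
Proof.
move=> ainj /cuntz_leP ab.
have [[ca fa] pa] := (fixed_positiveK a, @fixed_positive_ge0 _ _ _ a).
have [[cb fb] pb] := (fixed_positiveK b, @fixed_positive_ge0 _ _ _ b).
have [la lb] := (proj1 ca, proj1 cb).
have [ea eb] := (fixed_equivariant fa, fixed_equivariant fb).
have k0 (k : nat) : 0 < k.+1%:R^-1 :> R by rewrite invr_gt0.
have /choice[F FP] : forall k : nat,
    exists s : {n : nat & (('I_n -> mu) * ('I_n -> R))%type},
    spectral_family a k.+1%:R^-1 (projT2 s).1 (projT2 s).2.
  move=> k; have [n [e [l sf]]] := spectral_family_exists ca pa (k0 k).
  by exists (existT _ n (e, l)).
pose P k := finite_rank (projT2 (F k)).1 (projT2 (F k)).1.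
have on k : orthonormal_family (projT2 (F k)).1 by have [] := FP k.
have eP k : equivariant (P k).
  by move=> g x; rewrite /P -!(fcalc1 _ (projT2 (F k)).2);
     exact: (fcalc_equivariant _ ca pa ea (FP k)).
have PP k j x : (k <= j)%N -> P j (P k x) = P k x.
  move=> kj; have lP : linear (P j) by have [] := finite_rank_compact (projT2 (F j)).1 (projT2 (F j)).1.
  rewrite (linear_op_sum _ _ lP); apply: eq_bigr => i _; congr (_ *: _).
  have [_ ae le_l _] := FP k; have [_ _ _ /(_ _ _ _ (ae i))] := FP j; apply.
  by rewrite (le_trans _ (le_l i)) // lef_pV2 ?posrE // ler_nat ltnS.
have PA k : adjoint (P k) (P k) by exact: onproj_adjoint.
have Papprox x (e : R) : 0 < e ->
    exists N, forall k, (N <= k)%N -> hnorm (x - P k x) <= e.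
  move=> e0; have [|d d0 dP] := @spectral_approx _ _ a x e ca pa _ e0.
    by move=> z /ainj ->; rewrite dot0r.
  have [N NP] := invS_small d0; exists N => k Nk.
  exact: dP (k0 k) (NP k Nk) (FP k).
have Lex k : exists (L : mu -> nu) L', [/\ linear L, bounded_op L, equivariant L,
    adjoint L L' & forall x, P k x = x -> L x = 0 -> x = 0].
  (* On the range of [P k] the operator [a] is bounded below by [1 / (k + 1)]. If [b (ds x) = 0],
     the approximation with half this precision bounds [a x] by half of that multiple of the norm of
     [x], so [x = 0]. *)
  have [|d [ds [[cd fd] dds dP]]] := ab (k.+1%:R^-1 / 2); first by rewrite divr_gt0.
  have sdd := adjoint_sym dds.
  have lds := adjoint_linear dds.
  have bds := adjoint_bounded dds (compact_op_bounded cd).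
  exists (b \o ds), (d \o b); split.
  - by move=> c x y /=; rewrite lds lb.
  - by apply: bounded_op_comp => //; exact: compact_op_bounded.
  - by move=> g x /=; rewrite (adjoint_fixed dds (fixed_equivariant fd)) eb.
  - by move=> x y /=; rewrite (positive_op_adjoint lb pb) sdd.
  move=> x Px /= Lx; apply/hnorm_eq0/eqP; rewrite eq_le hnorm_ge0 andbT.
  have := spectral_lower ca (FP k) x; rewrite -/(P k) Px => h1.
  have := dP x; rewrite Lx (linear_op0 (proj1 cd)) sub0r hnormN => h2.
  have := le_trans h1 h2; rewrite mulrAC ler_pdivlMr // -subr_ge0.
  rewrite (_ : _ - _ = - (k.+1%:R^-1 * hnorm x)); last by ring.
  by rewrite oppr_ge0 pmulr_rle0.
(* A good pair at stage [k] is an equivariant partial isometry with initial space the range of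
   [P k], together with its adjoint. *)
pose good k (st : (mu -> nu) * (nu -> mu)) := [/\ linear st.1, equivariant st.1,
  adjoint st.1 st.2, bounded_op st.1 & forall x, st.2 (st.1 x) = P k x].
have polar_good k (st : (mu -> nu) * (nu -> mu)) : linear st.1 -> bounded_op st.1 ->
    equivariant st.1 -> adjoint st.1 st.2 -> exists st', good k st' /\
    forall x, P k x = x -> st.2 (st.1 x) = x ->
      hnorm (st'.1 x - st.1 x) <= 2^-1 ^+ k * hnorm x.
  move=> lu bu eu uu'; have [L [L' [lL bL eL LL' Linj]]] := Lex k.
  have eta0 : 0 < 2^-1 ^+ k :> R by rewrite exprn_gt0 // invr_gt0.
  have [v [v' [[lv ev vv'] vP vu]]] :=
    polar_perturbation (on k) (eP k) lu bu eu uu' lL bL eL LL' Linj eta0.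
  exists (v, v'); split=> //; split=> //=.
  exists 1; split=> // x; rewrite mul1r.
  apply: le_trans (onproj_le (on k) x); rewrite -/(P k x).
  rewrite -ler_sqr ?nnegrE ?hnorm_ge0 //.
  suff -> : hnorm (v x) ^+ 2 = hnorm (P k x) ^+ 2 by [].
  apply: (@complexI R); rewrite -!dotp_hnorm vv' vP.
  by rewrite PA PP.
(* Perturbing the zero map already produces an embedding of the first spectral subspace. *)
have [st0 good0] : exists st0, good 0%N st0.
  have [||||st0 []] := @polar_good 0%N (fun=> 0, fun=> 0).
  - by move=> c x y /=; rewrite scaler0 addr0.
  - by exists 1; split=> // x /=; rewrite hnorm0 mul1r hnorm_ge0.
  - by move=> g x /=; rewrite linear_op0 //; exact: rep_linear.
  - by move=> x y /=; rewrite dot0l dot0r.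
  - by exists st0.
have /choice[next nextP] : forall p : nat * ((mu -> nu) * (nu -> mu)),
    exists st', good p.1 p.2 -> good p.1.+1 st' /\
    forall x, P p.1 x = x -> hnorm (st'.1 x - p.2.1 x) <= 2^-1 ^+ p.1 * hnorm x.
  move=> [k st]; have [[lu eu uu' bu uP]|nst] := pselect (good k st); last by exists st.
  have [st' [gst' st'P]] := polar_good k.+1 st lu bu eu uu'.
  exists st' => _; split=> // x Px.
  apply: le_trans (st'P x _ _) _.
  - by rewrite -Px PP.
  - by rewrite uP.
  rewrite ler_wpM2r ?hnorm_ge0 // exprS ler_piMl ?exprn_ge0 ?invr_ge0 //.
  by rewrite invf_le1 // ler1n.
pose st := fix st k := if k is k'.+1 then next (k', st k') else st0.
have gst k : good k (st k) by elim: k => //= k IH; have [] := nextP (k, st k) IH.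
pose u k := (st k).1.
have lu k : linear (u k) by have [] := gst k.
have eu k : equivariant (u k) by have [] := gst k.
have un k x : hnorm (u k x) = hnorm (P k x).
  apply/eqP; rewrite -(@eqrXn2 _ 2) ?hnorm_ge0 //; apply/eqP.
  have [_ _ uu' _ uP] := gst k.
  apply: (@complexI R); rewrite -!dotp_hnorm uu' uP.
  by rewrite PA PP.
have ule k x : hnorm (u k x) <= hnorm x.
  by rewrite un; exact: onproj_le.
have ustep k x : P k x = x -> hnorm (u k.+1 x - u k x) <= 2^-1 ^+ k * hnorm x.
  by move=> Px; have [_] := nextP (k, st k) (gst k); apply.
(* The constant is the geometric sum of the [2^-j] for [m <= j < m + i]. *)
have ufar m i x : P m x = x ->
    hnorm (u (m + i)%N x - u m x) <= 2 * (2^-1 ^+ m - 2^-1 ^+ (m + i)) * hnorm x.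
  move=> Px; elim: i => [|i IH].
    by rewrite addn0 !subrr hnorm0 mulr0 mul0r.
  rewrite addnS (le_trans (hnormB_le _ (u (m + i)%N x) _)) //.
  have /ustep h : P (m + i)%N x = x by rewrite -Px PP ?leq_addr.
  have half : 2 * (2^-1 * 2^-1 ^+ (m + i)) = 2^-1 ^+ (m + i) :> R.
    by rewrite mulrA mulfV ?mul1r // pnatr_eq0.
  rewrite exprS (le_trans (lerD h IH)) // -mulrDl.
  by rewrite !mulrBr half mulrDl mulrBl mulrBl; lra.
have ucauchy x (e : R) : 0 < e -> exists N, forall m n, (N <= m)%N -> (N <= n)%N ->
    hnorm (u m x - u n x) <= e.
  (* Write [x = y + z] with [y] in the range of [P N] and [z] of norm at most [e / 8]. Past [N],
     each [u j x] is within [e / 8] (from [z]) plus [e / 4] (from [y]) of [u N y], so two of them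
     differ by at most [3e / 4]. *)
  move=> e0; have e8 : 0 < e / 8 by rewrite divr_gt0.
  have [N1 N1P] := Papprox x _ e8.
  have x1 : 0 < hnorm x + 1 by rewrite ltr_wpDl // hnorm_ge0.
  have [N2 N2P] := invS_small (divr_gt0 e8 x1).
  pose N := maxn N1 N2; exists N.
  pose y := P N x; pose z := x - y.
  have Py : P N y = y by exact: PP.
  have zn : hnorm z <= e / 8 by apply: N1P; rewrite leq_maxl.
  have yn : hnorm y <= hnorm x by exact: onproj_le.
  have near_uN j : (N <= j)%N -> hnorm (u j x - u N y) <= e / 8 + e / 4.
    move=> Nj; have -> : u j x = u j z + u j y.
      by rewrite -(linear_opD _ _ (lu j)) subrK.
    rewrite -addrA (le_trans (hnormD _ _)) // lerD ?(le_trans (ule _ _)) //.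
    rewrite -(subnKC Nj) (le_trans (ufar _ _ _ Py)) //.
    apply: (@le_trans _ _ (2 * (e / 8 / (hnorm x + 1)) * hnorm x)).
      apply: ler_pM => //; rewrite ?hnorm_ge0 //.
        rewrite mulr_ge0 // subr_ge0 exprD ler_piMr ?exprn_ge0 ?invr_ge0 //.
        by rewrite exprn_ile1 ?invr_ge0 // invf_le1 // ler1n.
      rewrite ler_pM2l // (@le_trans _ _ (2^-1 ^+ N)) //.
        by rewrite gerBl exprn_ge0 // invr_ge0.
      by rewrite (le_trans (half_expr_le N)) // N2P // leq_maxr.
    rewrite mulrA mulrAC ler_pdivrMr //; have := hnorm_ge0 x; nra.
  move=> m n /near_uN hm /near_uN hn.
  rewrite (le_trans (hnormB_le _ (u N y) _)) //.
  move: hm hn; rewrite (hnormB_sym (u n x)); lra.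
have /choice[U UP] : forall x : mu, exists l : nu, (u k x) @[k --> \oo] --> l.
  move=> x; have [l lP] := hcauchy_limit (ucauchy x).
  by exists l; exact: hnorm_cvg.
have Ucvg (x : mu) (l : nu) : (u k x) @[k --> \oo] --> l -> U x = l.
  by move=> ul; apply: (cvg_unique _ (UP x) ul); exact: norm_hausdorff.
have lU : linear U.
  move=> c x y; apply: Ucvg.
  rewrite [X in X @ _](_ : _ = fun k => c *: u k x + u k y); last first.
    by apply/funext => k; rewrite lu.
  by apply: cvgD; [apply: cvgZr; exact: UP|exact: UP].
have nU x : hnorm (U x) = hnorm x.
  have Px : (P k x) @[k --> \oo] --> x.
    apply: hnorm_cvg => e /(Papprox x)[N NP]; exists N => k /NP.
    by rewrite hnormB_sym.
  apply: (@cvg_unique _ (@Rhausdorff R) (hnorm (P k x) @[k --> \oo])).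
    rewrite (_ : (fun k => hnorm (P k x)) = (@hnorm R nu \o u ^~ x)); last first.
      by apply/funext => k /=; rewrite un.
    by apply: continuous_cvg; [exact: hnorm_continuous|exact: UP].
  by apply: (@continuous_cvg _ _ _ _ _ _ (@hnorm R mu)); [exact: hnorm_continuous|exact: Px].
apply: (@isometric_rep_le _ _ U) => //; first exact: isometric_of_hnorm.
move=> g x; apply: Ucvg.
rewrite (_ : (fun k => u k (rep_act g x)) = (rep_act g \o u ^~ x)); last first.
  by apply/funext => k /=; rewrite eu.
apply: continuous_cvg; last exact: UP.
apply: bounded_linear_op_continuous; first exact: rep_linear.
exists 1; split=> // y; rewrite mul1r isometric_hnorm //; exact: rep_isometric.
Qed.

End CuntzLeRepLe.

(** * Subrepresentations *)

Section SubHilbert.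
Context (R : realType) (H : hilbertType R) (M : set H) (sM : subspace M).

(** The predicate carries the proof [sM], so that closure under linear combinations can be attached
    to it and the subtype inherits its module structure. *)
Definition subhilbert_pred of subspace M : {pred H} := fun x => `[< M x >].

Lemma subhilbert_closed : submod_closed (subhilbert_pred sM).
Proof.
have [_ M0 lM] := sM.
by split=> [|c x y /asboolP Mx /asboolP My]; apply/asboolP => //; exact: lM.
Qed.

HB.instance Definition _ :=
  GRing.isSubmodClosed.Build R[i] H (subhilbert_pred sM) subhilbert_closed.

Inductive subhilbert : Type := SubHilbert x & x \in subhilbert_pred sM.

Definition subhilbert_val (u : subhilbert) : H := let: SubHilbert x _ := u in x.

HB.instance Definition _ := [isSub of subhilbert for subhilbert_val].
HB.instance Definition _ := [Choice of subhilbert by <:].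
HB.instance Definition _ := [SubChoice_isSubLmodule of subhilbert by <:].

Lemma subhilbert_val_linear c (x y : subhilbert) :
  val (c *: x + y) = c *: val x + val y.
Proof. exact: linearP. Qed.

Definition subhilbert_norm (x : subhilbert) : R[i] := `|val x|.

Lemma subhilbert_normD x y :
  subhilbert_norm (x + y) <= subhilbert_norm x + subhilbert_norm y.
Proof. by rewrite /subhilbert_norm raddfD ler_normD. Qed.

Lemma subhilbert_normZ (c : R[i]) x :
  subhilbert_norm (c *: x) = `|c| * subhilbert_norm x.
Proof. by rewrite /subhilbert_norm linearZ normrZ. Qed.

Lemma subhilbert_norm_eq0 x : subhilbert_norm x = 0 -> x = 0.
Proof. by move/normr0_eq0 => x0; apply: val_inj; rewrite x0 raddf0. Qed.

HB.instance Definition _ := Lmodule_isNormed.Build R[i] subhilbert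
  subhilbert_normD subhilbert_normZ subhilbert_norm_eq0.

Lemma subhilbert_normE (x : subhilbert) : `|x| = `|val x|.
Proof. by []. Qed.

Lemma subhilbert_complete (F : set_system subhilbert) :
  ProperFilter F -> cauchy F -> cvg F.
Proof.
move=> FF /cauchy_ballP cF.
have c1 : cvg (val @ F : set_system H).
  apply/cauchy_cvgP/cauchy_ballP => e e0.
  have [[A B] /= [FA FB] AB] := cF _ e0.
  exists (val @` A, val @` B); first by split=> /=;
    [apply: filterS FA|apply: filterS FB] => x Ax; exists x.
  move=> [_ _] /= [[x Ax <-] [y By <-]].
  have /= := AB (x, y) (conj Ax By); rewrite -!ball_normE /=.
  by rewrite subhilbert_normE raddfB.
move/cvg_ex : c1 => [l lP]; have [clM _ _] := sM.
have Ml : M l.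
  apply: (@closed_cvg _ _ F _ val M clM _ l lP); apply: nearW => x.
  by case: x => x Mx; apply/asboolP.
apply/cvg_ex; exists (SubHilbert (introT (asboolP _) Ml)).
apply/cvgrPdist_lt => e e0; move/cvgrPdist_lt: lP => /(_ e e0).
by apply: filterS => x; rewrite subhilbert_normE raddfB.
Qed.

HB.instance Definition _ := Uniform_isComplete.Build subhilbert subhilbert_complete.

Definition subhilbert_dot (x y : subhilbert) : R[i] := dotp (val x) (val y).

Lemma subhilbert_dot_bilinear :
  bilinear_for *%R (@Num.conj R[i] \; *%R) subhilbert_dot.
Proof.
split=> u c x y; rewrite /subhilbert_dot subhilbert_val_linear.
  by rewrite linearPl.
by rewrite linearPr.
Qed.

HB.instance Definition _ := bilinear_isBilinear.Build R[i] subhilbert subhilbert R[i]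
  *%R (@Num.conj R[i] \; *%R) subhilbert_dot subhilbert_dot_bilinear.

Lemma subhilbert_dot_hermitian (x y : subhilbert) :
  subhilbert_dot x y = (-1) ^+ false * Num.conj (subhilbert_dot y x).
Proof. by rewrite expr0 mul1r /subhilbert_dot -dotpC. Qed.

HB.instance Definition _ := isHermitianSesquilinear.Build R[i] subhilbert false
  (@Num.conj R[i]) subhilbert_dot subhilbert_dot_hermitian.

Lemma subhilbert_dot_norm (x : subhilbert) : subhilbert_dot x x = `|x| ^+ 2.
Proof. exact: dotp_norm. Qed.

Lemma subhilbert_dot_gt0 (x : subhilbert) : x != 0 -> 0 < subhilbert_dot x x.
Proof. by move=> x0; rewrite subhilbert_dot_norm exprn_gt0 // normr_gt0. Qed.

HB.instance Definition _ :=
  isDotProduct.Build R[i] subhilbert subhilbert_dot subhilbert_dot_gt0.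

HB.instance Definition _ :=
  CompleteNormedModule_isHilbert.Build R subhilbert subhilbert_dot_norm.

Lemma subhilbert_valP (x : subhilbert) : M (val x).
Proof. by case: x => x Mx; apply/asboolP. Qed.

(** The projections of a countable dense set are dense in [M]: by Pythagoras, projecting a point
    does not increase its distance to a vector of [M]. *)
Lemma subhilbert_separable : separable_space H -> separable_space subhilbert.
Proof.
move=> [A [cA dA]].
have /choice[p pP] : forall x : H, exists y : subhilbert, orth M (x - val y).
  move=> x; have [y My xy] := projection x sM.
  by exists (SubHilbert (introT (asboolP _) My)).
exists (p @` A); split; first exact: sub_countable (card_image_le p A) cA.
move=> O [x Ox] oO.
have /nbhs_ballP[e /= e0 eO] : nbhs x O by exact: open_nbhs_nbhs.
have [a [/interior_subset xa Aa]] := dA _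
  (ex_intro _ (val x) (nbhsx_ballx (val x) _ e0)) (@open_interior _ _).
exists (p a); split; last by exists a.
apply: eO; move: xa; rewrite -!ball_normE /=; apply: le_lt_trans.
rewrite subhilbert_normE raddfB hnorm_le -ler_sqr ?nnegrE ?hnorm_ge0 //.
have -> : val x - a = (val x - val (p a)) + (val (p a) - a) by rewrite subrKA.
rewrite [leRHS]hnorm_pythagoras ?lerDl ?sqr_ge0 //.
apply: dotp_swap0; rewrite -opprB dotNl pP ?oppr0 //.
by apply: subspaceB => //; exact: subhilbert_valP.
Qed.

End SubHilbert.

Section SubRepresentation.
Context (R : realType) (G : topologicalGroupType) (mu : unitary_rep R G)
  (M : set mu) (sM : subrep M).

Lemma subrep_subspace : subspace M.
Proof. by case: sM. Qed.

Local Notation S := (subhilbert subrep_subspace).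

Lemma subrep_act_mem g (x : S) : rep_act g (val x) \in subhilbert_pred subrep_subspace.
Proof.
by have [_ _ _ gM] := sM; apply/asboolP/gM; exact: subhilbert_valP.
Qed.

Definition subrep_act (g : G) (x : S) : S := SubHilbert (subrep_act_mem g x).

Lemma subrep_act1 : subrep_act 1%g = id.
Proof. by apply/funext => x; apply: val_inj; rewrite /= rep_act1. Qed.

Lemma subrep_actM g h : subrep_act (g * h)%g = subrep_act g \o subrep_act h.
Proof. by apply/funext => x; apply: val_inj; rewrite /= rep_actM. Qed.

Lemma subrep_unitary g : unitary (subrep_act g).
Proof.
split.
- move=> c x y; apply: val_inj; rewrite [RHS]subhilbert_val_linear.
  by rewrite -[LHS]/(rep_act g (val (c *: x + y))) subhilbert_val_linear rep_linear.
- by move=> x y; exact: rep_isometric.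
- apply/seteqP; split=> // y _; exists (subrep_act g^-1%g y) => //.
  by apply: val_inj; rewrite /= rep_actVK.
Qed.

Lemma subrep_continuous x : continuous (subrep_act ^~ x).
Proof.
move=> g; apply/cvgrPdist_lt => e e0.
have /cvgrPdist_lt/(_ e e0) := @rep_continuous _ _ mu (val x) g.
by apply: filterS => h; rewrite subhilbert_normE raddfB.
Qed.

Definition subrep_rep : unitary_rep R G :=
  UnitaryRep (subhilbert_separable subrep_subspace (@rep_separable _ _ mu))
    subrep_unitary subrep_act1 subrep_actM subrep_continuous.

Definition subrep_val (x : subrep_rep) : mu := val x.

Lemma subrep_val_linear : linear subrep_val.
Proof. by move=> c x y; exact: subhilbert_val_linear. Qed.

Lemma subrep_val_isometric : isometric subrep_val.
Proof. by []. Qed.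

Lemma subrep_val_equivariant : equivariant subrep_val.
Proof. by []. Qed.

Lemma subrep_val_range : range subrep_val = M.
Proof.
apply/seteqP; split=> [_ [x _ <-]|x Mx]; first exact: subhilbert_valP.
by exists (SubHilbert (introT (asboolP _) Mx)).
Qed.

End SubRepresentation.

(** * Cuntz classes of injective operators *)

Section StrictlyPositiveClasses.
Context (R : realType) (G : topologicalGroupType).
Implicit Types mu nu : unitary_rep R G.

Lemma rep_le_refl mu : rep_le mu mu.
Proof. exact: (@isometric_rep_le _ _ _ _ id). Qed.

Lemma rep_equiv_le mu nu : rep_equiv mu nu -> rep_le mu nu.
Proof. by move=> [U [[lU iU _] eU]]; exact: (isometric_rep_le lU iU eU). Qed.

Lemma cuntz_le_inj mu nu (a : fixed_positive mu) (b : fixed_positive nu) :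
  (forall x, a x = 0 -> x = 0) -> (forall x, b x = 0 -> x = 0) ->
  rep_le mu nu <-> cuntz_le a b.
Proof.
move=> ainj binj; split; last exact: cuntz_le_rep_le.
move=> [_ [_ [U [[lU iU _] eU]]]].
apply: (cuntz_le_partial_isometry lU eU) => [x y|x z /binj ->]; first exact: iU.
by rewrite dot0r.
Qed.

(** The inclusion of [(ker a)^perp] and its adjoint give the two comparisons. The adjoint is
    isometric only on [(ker a)^perp], which suffices because the range of [a] lies there. *)
Lemma fixed_positive_subrep mu (a : fixed_positive mu) :
  exists nu, forall b : fixed_positive nu, (forall x, b x = 0 -> x = 0) ->
    cuntz_le a b /\ cuntz_le b a.
Proof.
have [[ca fa] pa] := (fixed_positiveK a, @fixed_positive_ge0 _ _ _ a).
have [la _] := ca; have aa := positive_op_adjoint la pa.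
have ea := fixed_equivariant fa.
pose M := orth [set z : mu | a z = 0].
have sM : subrep M.
  have [clM M0 lM] := orth_subspace [set z : mu | a z = 0].
  split=> // g x Mx z /= az; rewrite rep_adjoint; apply: Mx => /=.
  by rewrite ea az linear_op0 //; exact: rep_linear.
have aM x : M (a x) by move=> z /= az; rewrite aa az dot0r.
exists (subrep_rep sM) => b binj.
pose j := @subrep_val _ _ _ _ sM.
have lj : linear j := @subrep_val_linear _ _ _ _ sM.
have ij : isometric j := @subrep_val_isometric _ _ _ _ sM.
have ej : equivariant j := @subrep_val_equivariant _ _ _ _ sM.
have [V [jV jK _]] := isometric_adjoint lj ij.
have lV := adjoint_linear jV.
have eV : equivariant V by exact: adjoint_fixed jV ej.
have aE x : exists w, a x = j w.
  have : range j (a x) by rewrite subrep_val_range.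
  by move=> [w _ <-]; exists w.
split.
  apply: (cuntz_le_partial_isometry lV eV) => [x y|x z /binj ->]; last by rewrite dot0r.
  by have [[v ->] [w ->]] := (aE x, aE y); rewrite !jK ij.
apply: (cuntz_le_partial_isometry lj ej) => [x y|x z az]; first exact: ij.
have : M (j (b x)) by exact: subhilbert_valP.
exact.
Qed.

End StrictlyPositiveClasses.

Theorem theorem3p4 (R : realType) (G : topologicalGroupType)
  (G_compact : compact [set: G]%classic) (G_hausdorff : hausdorff_space G)
  (s : forall mu : unitary_rep R G, fixed_positive mu)
  (s_strict : forall mu : unitary_rep R G, strictly_positive (s mu)) :
  exists S : Cu R G -> CuG R G,
    [/\ forall mu : unitary_rep R G, S (Cu_class mu) = CuG_class (s mu),
        bijective S,
        forall x y : Cu R G, S (Cu_add x y) = CuG_add (S x) (S y)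
      & forall x y : Cu R G, Cu_le x y <-> CuG_le (S x) (S y)].
Proof.
have sinj mu x : s mu x = 0 -> x = 0 by exact: strictly_positive_inj.
have s_le mu nu : rep_le mu nu <-> cuntz_le (s mu) (s nu).
  by apply: cuntz_le_inj; exact: sinj.
pose S (x : Cu R G) : CuG R G := CuG_class (s (repr_of x)).
have SE mu : S (Cu_class mu) = CuG_class (s mu).
  have eqv := rep_equiv_repr mu.
  apply/CuG_eqP; split; apply/s_le/rep_equiv_le => //.
  exact: rep_equiv_sym.
have CuE (x : Cu R G) : exists mu, x = Cu_class mu.
  by exists (repr_of x); rewrite /Cu_class repr_ofK.
have S_le x y : Cu_le x y <-> CuG_le (S x) (S y).
  have [[mu ->] [nu ->]] := (CuE x, CuE y); rewrite !SE.
  split; first by move=> /Cu_leE/s_le/CuG_leE.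
  by move=> /CuG_leE/s_le/Cu_leE.
have Sinj x y : S x = S y -> x = y.
  have [[mu ->] [nu ->]] := (CuE x, CuE y); rewrite !SE => /CuG_eqP[/s_le h1 /s_le h2].
  exact/Cu_eqP/rep_le_antisym.
have Ssurj y : exists x, S x = y.
  have -> : y = CuG_class (projT2 (repr_of y)).
    by rewrite /CuG_class; case E : (repr_of y) => [mu a] /=; rewrite -E repr_ofK.
  have [nu nuP] := fixed_positive_subrep (projT2 (repr_of y)).
  exists (Cu_class nu); rewrite SE; apply/CuG_eqP.
  by have [] := nuP (s nu) (@sinj nu).
exists S; split=> //.
  exists (fun y => projT1 (cid (Ssurj y))) => [x|y].
    by apply: Sinj; case: cid.
  by case: cid.
move=> x y; have [[mu ->] [nu ->]] := (CuE x, CuE y).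
rewrite Cu_addE !SE CuG_addE; apply/CuG_eqP.
(* Both this sum and [s (rep_sum mu nu)] are injective on the same representation, so the identity
   embedding compares them in both directions. *)
have tinj z : fixed_positive_sum (s mu) (s nu) z = 0 -> z = 0.
  case: z => z1 z2 /= [/sinj -> /sinj ->]; reflexivity.
by split; apply/cuntz_le_inj => //; try exact: sinj; exact: rep_le_refl.
Qed.
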